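(* Let $1<\beta<2$ and let $\gamma=\inf\{\beta'\in S:\beta'\ge\beta\}$. Then for Lebesgue almost every $\lambda\in(0,1/\gamma)$, the Hausdorff dimension of the SRB-measure of $T_{\beta,\lambda}$ equals $1+\frac{\log\beta}{\log(1/\lambda)}$.
   Context: For $0<\lambda<1$ and $1<\beta<2$, let $Q=[0,1)\times[0,1)$ and define $T_{\beta,\lambda}\colon Q\to Q$ by $T_{\beta,\lambda}(x,y)=(\lambda x,\beta y)$ if $y<1/\beta$ and $T_{\beta,\lambda}(x,y)=(\lambda x+1-\lambda,\beta y-1)$ if $y\ge 1/\beta$. Let $\nu$ be two-dimensional Lebesgue measure on $Q$ and $\nu_n=\frac1n\sum_{k=0}^{n-1}\nu\circ T_{\beta,\lambda}^{-k}$; the SRB-measure of $T_{\beta,\lambda}$ is the (unique) weak limit of $\nu_n$ as $n\to\infty$ (equivalently the invariant measure whose conditional measures along unstable manifolds are equivalent to Lebesgue measure). $\beta$-shifts: for $\beta>1$ let $f_\beta(x)=\beta x\bmod 1$ on $[0,1]$, $d(x,\beta)=(\lfloor\beta f_\beta^{k-1}(x)\rfloor)_{k\ge1}$, and $S_\beta^+$ the closure in the product topology of $\{d(x,\beta):x\in[0,1)\}$. Let $S_\beta$ be the set of bi-infinite sequences $(\ldots,a_{-1},a_0,a_1,\ldots)$ with $(a_n,a_{n+1},\ldots)\in S_\beta^+$ for all $n\in\mathbb Z$, and $S_\beta^-$ the set of $(b_1,b_2,\ldots)$ such that $(\ldots,b_2,b_1,0,0,\ldots)\in S_\beta$ (with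 $b_1$ at position $0$ and zeros at positive positions). Define $S=\{\beta>1: S_\beta^+=S_\beta^-\}$. *)

(* Defs.v *)
From HB Require Import structures.
From mathcomp Require Import all_boot all_order all_algebra.
From mathcomp Require Import all_classical all_reals all_analysis.
Set Implicit Arguments. Unset Strict Implicit. Unset Printing Implicit Defensive.
Import Order.TTheory GRing.Theory Num.Theory numFieldNormedType.Exports.
Local Open Scope classical_set_scope.
Local Open Scope ring_scope.

Section Defs.
Variable R : realType.

Definition Qsq : set (R * R) :=
  [set z | 0 <= z.1 < 1 /\ 0 <= z.2 < 1].

Definition Tbl (beta lambda : R) (z : R * R) : R * R :=
  if z.2 < beta^-1 then (lambda * z.1, beta * z.2)
  else (lambda * z.1 + 1 - lambda, beta * z.2 - 1).

Definition leb2 := ((@lebesgue_measure R) \x (@lebesgue_measure R))%E.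

(** integral of f against nu_n = (1/n) sum_{k<n} nu o T^{-k},
    nu = Lebesgue measure on Q:  int f d(nu o T^{-k}) = int_Q f(T^k z) dz *)
Definition nu_n_int (beta lambda : R) (n : nat) (f : R * R -> R) : R :=
  n%:R^-1 * \sum_(k < n) Rintegral leb2 Qsq (fun z => f (iter k (Tbl beta lambda) z)).

Definition is_SRB_limit (beta lambda : R)
    (mu : {measure set (R * R) -> \bar R}) : Prop :=
  mu setT = 1%E /\ mu (~` Qsq) = 0%E /\
  forall f : R * R -> R,
    {within Qsq, continuous f} ->
    (exists M : R, forall z, Qsq z -> `|f z| <= M) ->
    (nu_n_int beta lambda n f) @[n --> \oo] --> Rintegral mu Qsq f.

Definition edist (x y : R * R) : R :=
  Num.sqrt ((x.1 - y.1) ^+ 2 + (x.2 - y.2) ^+ 2).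

(** diameter, with diam set0 = 0 *)
Definition diam (A : set (R * R)) : \bar R :=
  ereal_sup ([set 0%E] `|` [set (edist x y)%:E | x in A & y in A]).

Definition hausdorff_delta (s delta : R) (A : set (R * R)) : \bar R :=
  ereal_inf [set (\sum_(0 <= i <oo) ((fine (diam (U i))) `^ s)%:E)%E |
               U in [set U : nat -> set (R * R) |
                      A `<=` \bigcup_i U i /\ forall i, (diam (U i) <= delta%:E)%E]].

Definition hausdorff_measure (s : R) (A : set (R * R)) : \bar R :=
  ereal_sup [set hausdorff_delta s delta A | delta in [set d : R | 0 < d]].

Definition hausdorff_dim (A : set (R * R)) : \bar R :=
  ereal_inf [set s%:E | s in [set s : R | 0 <= s /\ hausdorff_measure s A = 0%E]].

Definition hausdorff_dim_measure (mu : {measure set (R * R) -> \bar R}) : \bar R :=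
  ereal_inf [set hausdorff_dim A | A in [set A : set (R * R) |
                                         measurable A /\ mu (~` A) = 0%E]].

Definition fbeta (beta x : R) : R := beta * x - (Num.floor (beta * x))%:~R.

(** d(x,beta)_{k+1} = floor (beta * f_beta^k x) *)
Definition dseq (beta x : R) : nat -> int :=
  fun k => Num.floor (beta * iter k (fbeta beta) x).

(** closure of {d(x,beta) : x in [0,1)} in the product topology of
    (discrete) digit sequences: every finite prefix is a prefix of some d(x,beta) *)
Definition Splus (beta : R) : set (nat -> int) :=
  [set s | forall n : nat, exists x : R, 0 <= x < 1 /\
             forall k : nat, (k < n)%N -> s k = dseq beta x k].

Definition Sbi (beta : R) : set (int -> int) :=
  [set a | forall n : int, Splus beta (fun k : nat => a (n + k%:Z)%R)].

(** b : nat -> int with b 0 = b_1 placed at position 0, b j at position -j,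
    zeros at positive positions *)
Definition Sminus (beta : R) : set (nat -> int) :=
  [set b | Sbi beta (fun m : int => if (0 < m)%R then 0%R else b (absz m))].

Definition Sset : set R := [set beta | 1 < beta /\ Splus beta = Sminus beta].

End Defs.

(* Main.v *)
Require Import Defs.
From HB Require Import structures.
From mathcomp Require Import all_boot all_order all_algebra.
From mathcomp Require Import all_classical all_reals all_analysis.
From mathcomp Require Import measurable_realfun.
From mathcomp Require Import zify ring lra.
Import Order.TTheory GRing.Theory Num.Theory numFieldNormedType.Exports.
Local Open Scope classical_set_scope.
Local Open Scope ring_scope.
Set Implicit Arguments. Unset Strict Implicit. Unset Printing Implicit Defensive.

(** No exceptional set of lambda is needed. Pick a self-dual base g in S with
beta <= g < 1/lambda. A reversed beta-word is the prefix of a g-expansion, so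
its value in base g is at most 1, and two pasts whose digits first differ j
steps back are at distance at least lambda^j (1 - lambda g): the images of the
cylinders along the contracting direction are separated, without any
transversality argument.

There are O(beta^n) words of length n. Testing a limit measure mu against bump
functions, separation gives mu(B(z, r)) <= C r^(1 + log beta / log (1/lambda))
for every ball, hence the lower bound; testing it against functions that vanish
on the lambda^m-neighbourhood of the points reachable in m steps shows that mu
lives on a set covered by O((beta / lambda)^m) squares of side lambda^m, hence
the upper bound.

For existence, the natural extension of the beta-transformation is a piecewise
affine area-preserving map of the region under the density
h(y) = sum_k beta^-k 1_(y < t_k), where t_k is the orbit of 1. Sending a point
of this region to the sum of its past digits weighted by powers of lambda gives
a T-invariant measure with vertical marginal h. The averages of Lebesgue measure
under the beta-transformation satisfy a renewal equation, which makes them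
converge to h, and since T contracts horizontally, the convergence of nu_n
follows for Lipschitz functions, then for all continuous ones by
inf-convolution. *)

(** * Digits of the beta-transformation *)

Section BetaExpansions.
Context {R : realType}.
Implicit Types (b l x y t : R) (m n k : nat) (w : seq bool).

(** Self-duality enters only through [past_inv_le]. Followed by zeros, a [b]-word and all its
    suffixes have value below 1 in the larger base [g], so the word is admissible at every position
    of a bi-infinite sequence of the [g]-shift; the equality of [Splus] and [Sminus] then lets the
    same digits be read backwards. Strictness of [l < g^-1] leaves the positive gap [1 - l * g].
    Both dimension bounds rely only on the defining properties in [is_SRB_limit], so they hold for
    every limit measure; the existence part keeps that statement from being vacuous. In the
    existence part the obstacle is that test functions are bounded and continuous on a half-open
    square, hence possibly not uniformly continuous, while [Tbl] jumps across [y = 1/b]. This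
    suggests a one-sided scheme: only a lower bound for the averages is proved, for minorants that
    are Lipschitz in the contracted coordinate and measurable in the other, and it is applied to
    both [f + M] and [M - f]. The averages along the beta-transformation are accordingly treated for
    bounded measurable functions. *)

Definition digit b y : bool := b^-1 <= y.

Definition fold_map b y : R := b * y - (digit b y)%:R.

Definition word b n y : seq bool :=
  mkseq (fun k => digit b (iter k (fold_map b) y)) n.

(** The newest digit has weight 1 and each step back costs a factor [l]. The ratio stays a parameter
    because the same sum is also evaluated at [g^-1], where it is, up to a factor, a value in base
    [g]. *)
Fixpoint past b l n y : R :=
  if n is n'.+1 then l * past b l n' y + (digit b (iter n' (fold_map b) y))%:R
  else 0.

Definition past_word l w : R := foldl (fun acc (d : bool) => l * acc + d%:R) 0 w.

Lemma Tbl_digit b l z :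
  Tbl b l z = (l * z.1 + (1 - l) * (digit b z.2)%:R, fold_map b z.2).
Proof.
rewrite /Tbl /fold_map /digit; case: ltP => h /=; congr pair; ring.
Qed.

Lemma iter_Tbl b l n z :
  iter n (Tbl b l) z =
  (l ^+ n * z.1 + (1 - l) * past b l n z.2, iter n (fold_map b) z.2).
Proof.
elim: n => [|n IH]; first by case: z => x y /=; congr pair; ring.
rewrite iterS IH Tbl_digit /=; congr pair; rewrite exprS; ring.
Qed.

Lemma past_word_past b l n y : past b l n y = past_word l (word b n y).
Proof.
rewrite /past_word /word; elim: n => // n IH.
by rewrite mkseqS foldl_rcons -IH.
Qed.

Lemma word_succ b n y : word b n.+1 y = digit b y :: word b n (fold_map b y).
Proof.
rewrite /word /mkseq /= -[1%N]addn0 iotaDl -map_comp; congr cons.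
by apply: eq_map => k; rewrite /= -iterSr.
Qed.

(** Equal digits cancel in the difference, so on a cylinder the iterate is affine of slope
    [b ^+ n]. *)
Lemma word_iter_sub b n y y' : word b n y = word b n y' ->
  iter n (fold_map b) y - iter n (fold_map b) y' = b ^+ n * (y - y').
Proof.
elim: n y y' => [|n IH] y y'; first by rewrite expr0 mul1r.
rewrite !word_succ => -[e /IH]; rewrite -!iterSr => ->.
by rewrite /fold_map e exprS; ring.
Qed.

Lemma eq_wordP b n y y' :
  (forall k, (k < n)%N ->
     digit b (iter k (fold_map b) y) = digit b (iter k (fold_map b) y')) ->
  word b n y = word b n y'.
Proof. by move=> e; apply/eq_in_map => k; rewrite mem_iota => /e. Qed.

Section Range.
Variables (b : R) (b_gt1 : 1 < b) (b_lt2 : b < 2).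

Let b_gt0 : 0 < b. Proof. exact: lt_trans b_gt1. Qed.

Lemma digitE y : digit b y = (1 <= b * y).
Proof. by rewrite /digit -[in RHS](mulfV (lt0r_neq0 b_gt0)) ler_pM2l. Qed.

Lemma fold_map_range y : 0 <= y < 1 -> 0 <= fold_map b y < 1.
Proof.
move: b_lt2 => b2 /andP[y0 y1]; rewrite /fold_map digitE.
have y0' : 0 <= b * y by rewrite mulr_ge0// ltW.
have y1' : b * y < b by rewrite -[ltRHS]mulr1 ltr_pM2l.
case: (lerP 1 (b * y)) => h; rewrite ?mulr1n ?subr0; apply/andP; split; lra.
Qed.

Lemma iter_fold_map_range n y : 0 <= y < 1 -> 0 <= iter n (fold_map b) y < 1.
Proof. by move=> y01; elim: n => //= n; exact: fold_map_range. Qed.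

(** Lists the words seen from [[0, t)]. Once [b * t > 1], digit 0 leads onto all of [[0, 1)] and
    digit 1 onto [[0, b * t - 1)]; the parameter [t] is what closes the recursion. *)
Fixpoint words n t : seq (seq bool) :=
  if n is n'.+1 then
    if 1 < b * t
    then map (cons false) (words n' 1) ++ map (cons true) (words n' (b * t - 1))
    else map (cons false) (words n' (b * t))
  else [:: [::]].

Lemma word_in_words n t y : t <= 1 -> 0 <= y < t -> word b n y \in words n t.
Proof.
move: b_gt1 b_lt2 => b1 b2.
elim: n t y => [|n IH] t y t1 /andP[y0 yt] //.
have ybt : b * y < b * t by rewrite ltr_pM2l.
have by0 : 0 <= b * y by rewrite mulr_ge0// ltW.
have bt2 : b * t <= b by rewrite -[leRHS]mulr1 ler_pM2l.
rewrite word_succ /= /fold_map digitE.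
case: ltP => ht; last first.
  have lt1 : b * y < 1 by exact: lt_le_trans ybt ht.
  rewrite leNgt lt1/= subr0 map_f//; apply: IH => //.
  by rewrite by0.
rewrite mem_cat; apply/orP; case: (lerP 1 (b * y)) => h; [right|left].
  by rewrite mulr1n map_f//; apply: IH; [lra | apply/andP; split; lra].
by rewrite subr0 map_f//; apply: IH => //; rewrite by0.
Qed.

(** Without branching [t] is merely scaled by [b]. With branching a copy of [words n 1] splits off,
    of size at most [M * b ^+ n], which is exactly paid for by the drop of [b * t] by 1. The final 1
    counts the branch that survives to the end. *)
Lemma size_words_le n t M : 0 <= t <= 1 -> 0 <= M ->
  (forall i, (i < n)%N -> (size (words i 1))%:R <= M * b ^+ i) ->
  (size (words n t))%:R <= b ^+ n * M * t + 1.
Proof.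
move: b_gt1 b_lt2 => b1 b2 t01 M0; elim: n t t01 => [|n IH] t /andP[t0 t1] hM /=.
  by rewrite expr0 mul1r lerDr mulr_ge0.
have bt0 : 0 <= b * t by rewrite mulr_ge0// ltW.
have bt2 : b * t <= b by rewrite -[leRHS]mulr1 ler_pM2l.
have hM' : forall i, (i < n)%N -> (size (words i 1))%:R <= M * b ^+ i.
  by move=> i ilt; apply: hM; exact: ltnW.
case: ltP => ht; last first.
  rewrite size_map (le_trans (IH _ _ hM'))//; first by rewrite bt0.
  by rewrite exprS le_eqVlt; apply/orP; left; apply/eqP; ring.
rewrite size_cat !size_map natrD.
have /IH : 0 <= b * t - 1 <= 1 by apply/andP; split; lra.
move=> /(_ hM') h2; have h1 := hM n (ltnSn n).
apply: le_trans (lerD h1 h2) _.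
by rewrite exprS le_eqVlt; apply/orP; left; apply/eqP; ring.
Qed.

(** At [t = 1] the previous lemma turns a constant valid for shorter lengths into one larger by
    [b^-1 ^+ k.+1] at length [k.+1]; starting from 1, these increments form a geometric series of
    sum [b / (b - 1)]. *)
Lemma words_count n : (size (words n 1))%:R <= b / (b - 1) * b ^+ n.
Proof.
move: b_gt1 => b1; pose M k : R := \sum_(i < k.+1) (b^-1) ^+ i.
have MS k : M k.+1 = M k + b^-1 ^+ k.+1 by rewrite /M big_ord_recr.
have Mmono i j : (i <= j)%N -> M i <= M j.
  elim: j => [|j IH]; first by rewrite leqn0 => /eqP->.
  rewrite leq_eqVlt => /orP[/eqP->//|/IH h]; apply: (le_trans h).
  by rewrite MS lerDl exprn_ge0// invr_ge0 ltW.
have M0 k : 0 <= M k.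
  by apply: sumr_ge0 => i _; rewrite exprn_ge0// invr_ge0 ltW.
have Mle k : M k <= b / (b - 1).
  have -> : M k = series (geometric 1 b^-1) k.+1.
    rewrite /M /series/= big_mkord; apply: eq_bigr => i _.
    by rewrite mul1r.
  have -> : b / (b - 1) = 1 * (1 - b^-1)^-1.
    by field; rewrite subr_eq0 !gt_eqF.
  have H := @geometric_le_lim R k.+1 1 b^-1 ler01.
  by apply: H; rewrite ?gtr0_norm ?invr_gt0 ?invf_lt1.
suff h k : (size (words k 1))%:R <= M k * b ^+ k.
  by apply: (le_trans (h n)); rewrite ler_wpM2r// exprn_ge0// ltW.
elim/ltn_ind: k => -[|k] IH.
  by rewrite /= /M big_ord1 !expr0 mulr1.
have := @size_words_le k.+1 1 (M k).
rewrite ler01 lexx => /(_ isT (M0 k)) h; apply: (le_trans (h _)).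
  move=> i ik; apply: (le_trans (IH _ ik)).
  by rewrite ler_wpM2r ?Mmono// exprn_ge0// ltW.
rewrite MS mulrDl mulr1 exprVn mulVf ?expf_neq0 ?gt_eqF//.
by rewrite [X in _ <= X + _]mulrC.
Qed.

End Range.
End BetaExpansions.

(** * Reversed digit words and separation of pasts *)

Section Separation.
Context {R : realType}.
Implicit Types (b g l x y : R) (d : nat -> bool).

(** Value in base [g] of the digits [d (n - 1), ..., d 0] followed by zeros. Raising [n] prepends a
    digit, so [d] is indexed from right to left, as pasts are in [Sminus]. *)
Fixpoint rev_value g d n : R :=
  if n is n'.+1 then ((d n')%:R + rev_value g d n') / g else 0.

Lemma rev_value_ge0 g d n : 0 < g -> 0 <= rev_value g d n.
Proof.
move=> g0; elim: n => //= n IH.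
by rewrite divr_ge0 ?addr_ge0 ?ler0n// ltW.
Qed.

Lemma dseq_succ g x k : dseq g x k.+1 = dseq g (fbeta g x) k.
Proof. by rewrite /dseq iterSr. Qed.

Lemma floor_bool_add (c : bool) (x : R) : 0 <= x < 1 -> Num.floor (c%:R + x) = c%:Z.
Proof.
move=> /andP[x0 x1]; apply: floor_def.
have -> : (c%:Z%:~R : R) = c%:R by [].
have -> : ((c%:Z + 1)%:~R : R) = c%:R + 1 by rewrite intrD.
by rewrite lerDl x0 ltrD2l.
Qed.

(** Multiplication by [g] brings out the integer [d j] and leaves the remainder [rev_value g d j],
    which is below 1; hence the greedy algorithm recovers the digits one at a time. *)
Lemma dseq_rev_value g d j k : 0 < g -> (forall n, rev_value g d n < 1) ->
  dseq g (rev_value g d j) k = if (k < j)%N then (d (j - k.+1)%N)%:Z else 0.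
Proof.
move=> g0 lt1; elim: j k => [|j IH] k.
  have f0 : fbeta g 0 = 0 by rewrite /fbeta mulr0 floor0 subr0.
  have {f0} -> : dseq g (rev_value g d 0) k = Num.floor (g * 0).
    by rewrite /dseq; congr (Num.floor (_ * _)); elim: k => //= k ->.
  by rewrite mulr0 floor0.
have z01 : 0 <= rev_value g d j < 1 by rewrite rev_value_ge0//= lt1.
have gz : g * rev_value g d j.+1 = (d j)%:R + rev_value g d j.
  by rewrite /= mulrC divfK// gt_eqF.
case: k => [|k].
  by rewrite /dseq /= -/(rev_value g d j.+1) gz floor_bool_add// subn1.
rewrite dseq_succ /fbeta gz floor_bool_add// addrC addKr IH ltnS.
by case: ltnP => // kj; rewrite subSS.
Qed.

(** Each window of the bi-infinite sequence is a word [d (n - 1), ..., d 0] followed by zeros, or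
    zeros alone, hence the expansion of a single point. *)
Lemma Sminus_rev_value g d : 0 < g -> (forall n, rev_value g d n < 1) ->
  Sminus g (fun k => (d k)%:Z).
Proof.
move=> g0 lt1 n N; case: n => [[|n]|n].
- exists (rev_value g d 1); rewrite rev_value_ge0// lt1; split=> // k _.
  by rewrite dseq_rev_value// add0r; case: k.
- exists 0; rewrite lexx ltr01; split=> // k _.
  by rewrite (dseq_rev_value 0 k g0 lt1).
(* [Negz n] is the position [-(n + 1)], which carries [d n.+1]; so [n + 2] digits precede the
   zeros. *)
- exists (rev_value g d n.+2); rewrite rev_value_ge0// lt1; split=> // k _.
  rewrite dseq_rev_value// NegzE.
  case: ltnP => kn.
    have -> : - n.+1%:Z + k%:Z = - (n.+2 - k.+1)%N%:Z.
      by rewrite -subzn// opprB -[k.+1]addn1 -[n.+2]addn1 !PoszD; ring.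
    by rewrite oppr_gt0/= abszN absz_nat.
  have -> : (0 < - n.+1%:Z + k%:Z)%R = true => //.
  by rewrite addrC subr_gt0 ltz_nat.
Qed.

Lemma fbeta_range g x : 0 <= fbeta g x < 1.
Proof.
rewrite /fbeta subr_ge0 floor_le_tmp /= ltrBlDr addrC.
by have := floorD1_gt (g * x); rewrite intrD.
Qed.

Section Reversal.
Variables (b g : R) (b_gt1 : 1 < b) (b_lt2 : b < 2).
Variables (b_le_g : b <= g) (gS : Sset g).

Let b_gt0 : 0 < b. Proof. exact: lt_trans b_gt1. Qed.
Let g_gt0 : 0 < g. Proof. exact: lt_le_trans b_le_g. Qed.

(** Up to index [m] this is a truncated forward [b]-expansion of an orbit point, and reading it in
    the larger base [g] can only lower it. Beyond [m] zeros are prepended, each of which divides by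
    [g]. *)
Lemma rev_value_reversed_word m y n : 0 <= y < 1 ->
  rev_value g (fun k => (k < m)%N && digit b (iter (m - k.+1) (fold_map b) y)) n
  < 1.
Proof.
move=> y01; set d := (fun k : nat => _).
have lem j : (j <= m)%N -> rev_value g d j <= iter (m - j) (fold_map b) y.
  elim: j => [_|j IH jm] /=.
    by have /andP[] := iter_fold_map_range b_gt1 b_lt2 (m - 0) y01.
  have {IH} := IH (ltnW jm); rewrite {2}/d jm /=.
  rewrite -(subnSK jm) iterS.
  set z := iter _ _ y => IH.
  have z0 : 0 <= z by have /andP[] := iter_fold_map_range b_gt1 b_lt2 (m - j.+1) y01.
  rewrite ler_pdivrMr//; apply: (@le_trans _ _ (b * z)).
    by rewrite /fold_map in IH; rewrite addrC -lerBrDr.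
  by rewrite mulrC ler_wpM2l.
elim: n => [|n IH]; first exact: ltr01.
case: (ltnP n m) => nm.
  apply: le_lt_trans (lem _ nm) _.
  by have /andP[] := iter_fold_map_range b_gt1 b_lt2 (m - n.+1) y01.
rewrite /= {1}/d ltnNge nm /= add0r ltr_pdivrMr// mul1r (lt_trans IH)//.
exact: lt_le_trans b_le_g.
Qed.

(* Reversed beta-words are expansions in the self-dual base [g >= b]. *)
Lemma past_inv_le m y : 0 <= y < 1 -> g^-1 * past b g^-1 m y <= 1.
Proof.
move=> y01; have [_ Seq] := gS.
have := Sminus_rev_value g_gt0 (fun n => rev_value_reversed_word m n y01).
(* The reversed word, now in [Splus], is a prefix of the expansion of some [x < 1], and a truncated
   expansion never exceeds its point. *)
rewrite -Seq => /(_ m)[x [/andP[x0 x1] dx]].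
suff h n z : 0 <= z ->
    (forall k, (k < n)%N ->
      (digit b (iter (n - k.+1) (fold_map b) y))%:Z = dseq g z k) ->
    g^-1 * past b g^-1 n y <= z.
  apply: le_trans (h m x x0 _) (ltW x1) => k km.
  by rewrite -dx// km.
elim: n z => [|n IH] z z0 dz; first by rewrite /= mulr0.
have h0 := dz 0%N isT; rewrite subn1/= in h0.
have {}IH := IH (fbeta g z) _ _.
have /IH : 0 <= fbeta g z by have /andP[] := fbeta_range g z.
have hk k : (k < n)%N ->
    (digit b (iter (n - k.+1) (fold_map b) y))%:Z = dseq g (fbeta g z) k.
  by move=> kn; rewrite -dseq_succ -dz.
move=> /(_ hk) /=.
have -> : fbeta g z = g * z - (digit b (iter n (fold_map b) y))%:R.
  by rewrite /fbeta -[Num.floor _]/(dseq g z 0) -h0.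
rewrite lerBrDr => h; rewrite mulrC ler_pdivrMr// [z * g]mulrC.
exact: h.
Qed.

Variables (l : R) (l_gt0 : 0 < l) (l_lt : l < g^-1).

Lemma past_ge0 n y : 0 <= past b l n y.
Proof.
by elim: n => //= n IH; rewrite addr_ge0 ?ler0n// mulr_ge0// ltW.
Qed.

(** Pasts increase with the ratio, and at the larger ratio [g^-1] the reversal bound applies. *)
Lemma past_le n y : 0 <= y < 1 -> past b l n y <= g.
Proof.
move=> y01; apply: (@le_trans _ _ (past b g^-1 n y)); last first.
  by have := past_inv_le n y01; rewrite mulrC ler_pdivrMr// mul1r.
elim: n => //= n IH; rewrite lerD2r ler_pM ?past_ge0//; exact: ltW.
Qed.

(** The older digits contribute to each past a quantity in [[0, l * g]], so distinct newest digits
    put the pasts at least [1 - l * g] apart. Equal newest digits cancel, and removing the common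
    factor [l] lowers the exponent in the hypothesis by one. *)
Lemma past_separation m n y y' : 0 <= y < 1 -> 0 <= y' < 1 ->
  `|past b l (n + m) y - past b l (n + m) y'| < (1 - l * g) * l ^+ m ->
  forall k, (n <= k < n + m)%N ->
  digit b (iter k (fold_map b) y) = digit b (iter k (fold_map b) y').
Proof.
move=> y01 y'01; elim: m => [|m IH].
  by move=> _ k; rewrite addn0 ltnNge; case: leqP.
have lg1 : l * g < 1 by rewrite -ltr_pdivlMr// mul1r.
have l1 : l < 1.
  by apply: lt_trans l_lt _; rewrite invf_lt1//; exact: lt_le_trans b_le_g.
rewrite addnS /=; set p := past b l (n + m) y; set p' := past b l (n + m) y'.
set e := digit b _; set e' := digit b _ => h.
have bd z : 0 <= z < 1 -> 0 <= l * past b l (n + m) z <= l * g.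
  move=> z01; rewrite mulr_ge0 ?past_ge0 ?(ltW l_gt0)//=.
  by rewrite ler_wpM2l ?past_le// ltW.
have /andP[p0 pg] := bd _ y01; have /andP[p'0 p'g] := bd _ y'01.
rewrite -/p -/p' in p0 pg p'0 p'g.
have h1 : (1 - l * g) * l ^+ m.+1 <= 1 - l * g.
  by rewrite ler_piMr ?subr_ge0 ?(ltW lg1)// exprn_ile1 ?(ltW l_gt0)// ltW.
have ee : e = e'.
  have := lt_le_trans h h1; rewrite ltr_norml => /andP[].
  by case: (e); case: (e') => //; rewrite ?mulr1n ?mulr0n; lra.
move=> k; rewrite ltnS leq_eqVlt (leq_eqVlt k) => /andP[nk /orP[/eqP->//|km]].
apply: IH; last by rewrite leq_eqVlt nk km.
move: h; rewrite ee exprS.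
have -> : l * p + e'%:R - (l * p' + e'%:R) = l * (p - p') by ring.
by rewrite normrM gtr0_norm// mulrCA ltr_pM2l.
Qed.

End Reversal.
End Separation.

(** * Measurability and covers by words *)

Section Measurability.
Context {R : realType}.
Implicit Types (b l x y r : R).

Lemma measurable_digit b : measurable_fun [set: R] (digit b).
Proof. by apply: measurable_fun_ler => //; exact: measurable_cst. Qed.

Lemma measurable_bool_natr d (T : measurableType d) (f : T -> bool) :
  measurable_fun setT f -> measurable_fun setT (fun t => (f t)%:R : R).
Proof.
move=> mf; rewrite (_ : (fun _ => _) = (fun t => if f t then 1 else 0)).
  exact: measurable_fun_ifT.
by apply/funext => t; case: (f t).
Qed.

Lemma measurable_fold_map b : measurable_fun [set: R] (fold_map b).
Proof.
apply: measurable_funB; last exact: measurable_bool_natr (measurable_digit b).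
by apply: measurable_funM => //; exact: measurable_cst.
Qed.

Lemma measurable_iter d (T : measurableType d) (f : T -> T) n :
  measurable_fun setT f -> measurable_fun setT (iter n f).
Proof.
move=> mf; elim: n => [|n IH] /=; first exact: measurable_id.
exact: (measurableT_comp mf IH).
Qed.

Lemma measurable_past b l n : measurable_fun [set: R] (past b l n).
Proof.
elim: n => [|n IH] /=; first exact: measurable_cst.
apply: measurable_funD.
  by apply: measurable_funM => //; exact: measurable_cst.
apply: measurable_bool_natr; apply: (measurableT_comp (@measurable_digit b)).
exact: measurable_iter (measurable_fold_map b).
Qed.

Lemma measurable_Tbl b l : measurable_fun [set: R * R] (Tbl b l).
Proof.
rewrite (_ : Tbl b l = fun z =>
    (l * z.1 + (1 - l) * (digit b z.2)%:R, fold_map b z.2)); last first.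
  by apply/funext => z; rewrite Tbl_digit.
apply: measurable_fun_pair; last first.
  exact: (measurableT_comp (@measurable_fold_map b) measurable_snd).
apply: measurable_funD; apply: measurable_funM => //; try exact: measurable_cst.
- exact: measurable_bool_natr (measurableT_comp (@measurable_digit b) measurable_snd).
Qed.

Lemma measurable_iter_Tbl b l n : measurable_fun [set: R * R] (iter n (Tbl b l)).
Proof. exact: measurable_iter (measurable_Tbl b l). Qed.

Lemma QsqE : @Qsq R = `[0, 1[%classic `*` `[0, 1[%classic.
Proof.
by apply/seteqP; split => -[x y]; rewrite /Qsq/= !in_itv/=.
Qed.

Lemma measurable_Qsq : measurable (@Qsq R).
Proof. by rewrite QsqE; apply: measurableX. Qed.

Lemma leb2_Qsq : leb2 (@Qsq R) = 1%E.
Proof.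
rewrite QsqE /leb2 product_measure1E//.
by rewrite /= !lebesgue_measure_itv/= lte_fin ltr01 oppr0 adde0 mule1.
Qed.

Lemma Tbl_Qsq b l z : 1 < b -> b < 2 -> 0 < l -> l < 1 -> Qsq z -> Qsq (Tbl b l z).
Proof.
move=> b1 b2 l0 l1 [/andP[x0 x1] y01]; rewrite Tbl_digit; split => /=; last first.
  exact: fold_map_range.
have lx0 : 0 <= l * z.1 by rewrite mulr_ge0// ltW.
have lx1 : l * z.1 < l by rewrite -[ltRHS]mulr1 ltr_pM2l.
by case: digit; rewrite ?mulr1n ?mulr0n; apply/andP; split; lra.
Qed.

Lemma iter_Tbl_Qsq b l n z : 1 < b -> b < 2 -> 0 < l -> l < 1 ->
  Qsq z -> Qsq (iter n (Tbl b l) z).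
Proof. by move=> b1 b2 l0 l1 Qz; elim: n => //= n; exact: Tbl_Qsq. Qed.

Lemma measure_bigsetU_le_sum d (T : measurableType d) (I : Type)
    (mu : {measure set T -> \bar R}) (s : seq I) (B : I -> set T) :
  (forall i, measurable (B i)) ->
  (mu (\big[setU/set0]_(i <- s) B i) <= \sum_(i <- s) mu (B i))%E.
Proof.
move=> mB; elim: s => [|i s IH]; first by rewrite !big_nil measure0.
rewrite !big_cons (le_trans (measureU2 _ _ _))//; last exact: leeD2l.
exact: bigsetU_measurable.
Qed.

(** One interval of radius [r], centred at a chosen point of [A], suffices for each cylinder, and
    [words_count] bounds the number of cylinders. *)
Lemma lebesgue_le_words b n (A : set R) r : 1 < b -> b < 2 -> 0 <= r ->
  measurable A -> A `<=` `[0, 1[ ->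
  (forall y y', A y -> A y' -> word b n y = word b n y' -> `|y - y'| <= r) ->
  (@lebesgue_measure R A <= (2 * r * (b / (b - 1) * b ^+ n))%:E)%E.
Proof.
move=> b1 b2 r0 mA A01 Ar.
pose c w := xget 0 (A `&` [set y | word b n y = w]).
pose B w := `[c w - r, c w + r]%classic.
have mB w : measurable (B w) by exact: measurable_itv.
have AB : A `<=` \big[setU/set0]_(w <- words b n 1) B w.
  move=> y Ay; rewrite -bigcup_seq; exists (word b n y) => /=.
    apply: word_in_words => //.
    by have := A01 _ Ay; rewrite /= in_itv.
  rewrite /B /= in_itv/=.
  have [] : (A `&` [set z | word b n z = word b n y]) (c (word b n y)).
    by rewrite /c; case: xgetP => [z -> //|/(_ y)]; case.
  move=> Ac /= ec; have := Ar _ _ Ay Ac (esym ec).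
  by rewrite ler_distl.
apply: (@le_trans _ _
    (lebesgue_measure (\big[setU/set0]_(w <- words b n 1) B w))).
  apply: le_measure; rewrite ?inE; [exact: mA| |exact: AB].
  by apply: bigsetU_measurable => w _; exact: mB.
apply: (le_trans (measure_bigsetU_le_sum (@lebesgue_measure R) _ mB)).
rewrite (eq_bigr (fun=> (2 * r)%:E)); last first.
  move=> w _; rewrite /B /= lebesgue_measure_itv/= lte_fin.
  have -> : (c w - r < c w + r) = (0 < r) by apply/idP/idP; lra.
  case: ltP => h; first by rewrite -EFinD; congr EFin; ring.
  by congr EFin; lra.
rewrite sumEFin lee_fin big_const_seq iter_addr_0 count_predT -[X in X <= _]mulr_natr.
by rewrite ler_wpM2l ?words_count// mulr_ge0.
Qed.

End Measurability.

(** * Testing a limit measure against continuous functions *)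

Section SRBLimits.
Context {R : realType}.
Variables (b l : R).

Lemma sum_lt_count n N : (\sum_(k < n) (k < N) = minn n N)%N.
Proof.
elim: n => [|n IH]; first by rewrite big_ord0 min0n.
by rewrite big_ord_recr/= IH; lia.
Qed.

Lemma ge0_integral_le_measure d (T : measurableType d)
    (mu : {measure set T -> \bar R}) (D A : set T) (f : T -> R) :
  measurable D -> measurable A -> measurable_fun D f ->
  (forall z, D z -> 0 <= f z <= 1) -> (forall z, D z -> ~ A z -> f z = 0) ->
  (\int[mu]_(z in D) (f z)%:E <= mu A)%E.
Proof.
move=> mD mA mf f01 fA.
apply: (@le_trans _ _ (\int[mu]_(z in D) (\1_A z)%:E)%E).
  apply: ge0_le_integral => //.
  - by move=> z Dz; rewrite lee_fin; have /andP[] := f01 _ Dz.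
  - exact/measurable_EFinP.
  - exact/measurable_EFinP/measurable_indic.
  - move=> z Dz; rewrite lee_fin indicE.
    have [Az|nAz] := pselect (A z).
      by rewrite mem_set//; have /andP[] := f01 _ Dz.
    by rewrite memNset// fA.
by rewrite integral_indic// le_measure ?inE//; exact: measurableI.
Qed.

(** [fine] sends [-oo] to 0, whence the sign condition on [K]. *)
Lemma Rintegral_le_EFin d (T : measurableType d)
    (mu : {measure set T -> \bar R}) (D : set T) (f : T -> R) K :
  (\int[mu]_(z in D) (f z)%:E <= K%:E)%E -> 0 <= K ->
  Rintegral mu D f <= K.
Proof.
rewrite /Rintegral; case: (\int[mu]_(z in D) (f z)%:E)%E => //=.
Qed.

Variables (mu : {measure set (R * R) -> \bar R}) (mu_SRB : is_SRB_limit b l mu).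

(** Only late times count: the first [N] terms of the average are at most 1 each, so together they
    weigh at most [N / n]. *)
Lemma SRB_integral_le (f : R * R -> R) N K : continuous f ->
  measurable_fun setT f -> (forall z, 0 <= f z <= 1) -> 0 <= K ->
  (forall k, (N <= k)%N ->
    (\int[@leb2 R]_(z in @Qsq R) (f (iter k (Tbl b l) z))%:E <= K%:E)%E) ->
  (\int[mu]_(z in @Qsq R) (f z)%:E <= K%:E)%E.
Proof.
move=> cf mf f01 K0 hK; have [muT [muQ lim]] := mu_SRB.
have int1 d (T : measurableType d) (nu : {measure set T -> \bar R})
    (g : T -> R) D : measurable D -> measurable_fun D g ->
    (forall z, 0 <= g z <= 1) -> (nu D <= 1)%E ->
    (\int[nu]_(z in D) (g z)%:E <= 1)%E.
  move=> mD mg g01 nuD; apply: le_trans nuD.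
  by apply: ge0_integral_le_measure.
have muQ1 : (mu (@Qsq R) <= 1)%E.
  by rewrite -muT le_measure ?inE//; exact: measurable_Qsq.
have mQ := @measurable_Qsq R.
have i1 : (\int[mu]_(z in @Qsq R) (f z)%:E <= 1)%E.
  by apply: int1 => //; exact: measurable_funTS.
have i0 : (0 <= \int[mu]_(z in @Qsq R) (f z)%:E)%E.
  by apply: integral_ge0 => z _; rewrite lee_fin; have /andP[] := f01 z.
have ifin : (\int[mu]_(z in @Qsq R) (f z)%:E)%E \is a fin_num.
  by rewrite ge0_fin_numE// (le_lt_trans i1)// ltry.
rewrite -(fineK ifin) lee_fin -/(Rintegral mu (@Qsq R) f).
have {}lim : nu_n_int b l n f @[n --> \oo] --> Rintegral mu (@Qsq R) f.
  apply: lim; first exact: continuous_subspaceT.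
  by exists 1 => z _; rewrite ger0_norm; have /andP[] := f01 z.
apply/ler_addgt0Pr => e e0.
rewrite -(cvg_lim _ lim)//; apply: limr_le; first by apply/cvg_ex; eexists; exact: lim.
near=> n.
have n0 : 0 < n%:R :> R by rewrite ltr0n; near: n; exact: nbhs_infty_gt.
have nN : N%:R <= e * n%:R.
  by rewrite -ler_pdivrMl// mulrC; near: n; exact: nbhs_infty_ger.
rewrite /nu_n_int ler_pdivrMl// mulrC.
apply: (@le_trans _ _ (\sum_(k < n) (K + (k < N)%:R))).
  apply: ler_sum => k _; apply: Rintegral_le_EFin; last first.
    by rewrite addr_ge0.
  case: ltnP => kN; last by rewrite addr0 hK.
  apply: (@le_trans _ _ 1%E); last by rewrite lee_fin lerDr.
  have Q1 : (@leb2 R (@Qsq R) <= 1)%E by rewrite leb2_Qsq.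
  rewrite /leb2 in Q1 *; apply: int1 Q1 => //.
  apply: measurable_funTS.
  exact: (measurableT_comp mf (measurable_iter_Tbl b l k)).
rewrite big_split/= sumr_const card_ord -[K *+ n]mulr_natr mulrDl lerD2l.
apply: le_trans nN; rewrite -natr_sum ler_nat.
by rewrite sum_lt_count geq_minr.
Unshelve. all: by end_near. Qed.

End SRBLimits.

(** * Mass of small boxes *)

Section MassBound.
Context {R : realType}.
Variables (b l g : R) (b_gt1 : 1 < b) (b_lt2 : b < 2).
Variables (b_le_g : b <= g) (gS : Sset g) (l_gt0 : 0 < l) (l_lt : l < g^-1).

Let b_gt0 : 0 < b. Proof. exact: lt_trans b_gt1. Qed.
Let g_gt0 : 0 < g. Proof. exact: lt_le_trans b_le_g. Qed.
Let l_lt1 : l < 1.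
Proof. by apply: lt_trans l_lt _; rewrite invf_lt1//; exact: lt_le_trans b_le_g. Qed.

(** The gap of [past_separation], rescaled by the factor [1 - l] with which [Tbl] places pasts in
    the unit interval. *)
Definition gap : R := (1 - l) * (1 - l * g).

Lemma gap_gt0 : 0 < gap.
Proof. by rewrite mulr_gt0 ?subr_gt0// -ltr_pdivlMr// mul1r. Qed.

(** Contains every height [y] from which some point [(x, y)] of the square reaches the box of
    half-side [2 * r] at time [k]; the unknown [x] costs at most [l ^+ k]. *)
Definition orbit_box k (x0 y0 r : R) : set R :=
  [set y | 0 <= y < 1 /\
    `|(1 - l) * past b l k y - x0| <= 2 * r + l ^+ k /\
    `|iter k (fold_map b) y - y0| <= 2 * r].

Lemma measurable_orbit_box k x0 y0 r : measurable (orbit_box k x0 y0 r).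
Proof.
have mleq (f : R -> R) (c : R) : measurable_fun setT f ->
    measurable [set y | `|f y| <= c].
  move=> mf; rewrite -[X in measurable X]setTI.
  by apply: measurable_fun_le => //; exact: measurableT_comp.
rewrite /orbit_box; apply: measurableI.
  rewrite [X in measurable X](_ : _ = `[0, 1[%classic); first exact: measurable_itv.
  by apply/seteqP; split => y /=; rewrite in_itv.
apply: measurableI; apply: mleq.
  apply: measurable_funB; last exact: measurable_cst.
  apply: measurable_funM; first exact: measurable_cst.
  exact: measurable_past.
apply: measurable_funB; last exact: measurable_cst.
exact: measurable_iter (measurable_fold_map b).
Qed.

(** Since [l ^+ k <= r], two rescaled pasts from this set are within [6 * r], so the last [m] digits
    are common and only the first [k - m] can vary. Within one word of length [k] the slope [b ^+ k]
    keeps heights within [4 * r / b ^+ k]. *)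
Lemma orbit_box_measure k m x0 y0 r : 0 < r -> (m <= k)%N -> l ^+ k <= r ->
  (m = 0)%N \/ 6 * r < gap * l ^+ m ->
  (@lebesgue_measure R (orbit_box k x0 y0 r)
   <= (8 * r * (b / (b - 1)) * b^-1 ^+ m)%:E)%E.
Proof.
move=> r0 mk lkr sep.
have bk (n : nat) : 0 < b ^+ n by rewrite exprn_gt0.
have := @lebesgue_le_words _ b (k - m) (orbit_box k x0 y0 r) (4 * r / b ^+ k)
  b_gt1 b_lt2.
have -> : 2 * (4 * r / b ^+ k) * (b / (b - 1) * b ^+ (k - m)) =
          8 * r * (b / (b - 1)) * b^-1 ^+ m.
  have -> : b ^+ k = b ^+ (k - m) * b ^+ m by rewrite -exprD subnK.
  rewrite exprVn; field.
  by rewrite !expf_neq0 ?gt_eqF// subr_gt0.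
apply.
- by rewrite divr_ge0 ?mulr_ge0 ?ltW.
- exact: measurable_orbit_box.
- by move=> y [y01 _]; rewrite /= in_itv.
move=> y y' [y01 [yx yy]] [y'01 [y'x y'y]] ew.
have eqw : word b k y = word b k y'.
  apply: eq_wordP => i ik; have [ikm|ikm] := ltnP i (k - m).
    have := congr1 (nth false ^~ i) ew; rewrite /word !nth_mkseq//.
  have [m0|h] := sep; first by move: ikm; rewrite m0 subn0 leqNgt ik.
  apply: (@past_separation _ b g b_gt1 b_lt2 b_le_g gS l l_gt0 l_lt m (k - m)) => //.
    rewrite subnK// -(ltr_pM2l (_ : 0 < 1 - l)) ?subr_gt0// mulrA.
    rewrite -{1}[1 - l]gtr0_norm ?subr_gt0// -normrM mulrBr.
    apply: le_lt_trans h; rewrite -/gap ler_norml.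
    by move: yx y'x; rewrite !ler_norml => /andP[? ?] /andP[? ?]; apply/andP; split; lra.
  by rewrite subnK// ikm.
rewrite ler_pdivlMr// mulrC -[b ^+ k]gtr0_norm// -normrM -word_iter_sub//.
move: yy y'y; rewrite !ler_norml => /andP[? ?] /andP[? ?]; apply/andP; split; lra.
Qed.

Variables (mu : {measure set (R * R) -> \bar R}) (mu_SRB : is_SRB_limit b l mu).

Definition box (x0 y0 r : R) : set (R * R) :=
  `[x0 - r, x0 + r]%classic `*` `[y0 - r, y0 + r]%classic.

Lemma measurable_box x0 y0 r : measurable (box x0 y0 r).
Proof. by apply: measurableX; exact: measurable_itv. Qed.

Definition box_bump (x0 y0 r : R) (z : R * R) : R :=
  Num.max 0 (Num.min 1 (2 - Num.max `|z.1 - x0| `|z.2 - y0| / r)).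

Lemma measurable_box_bump x0 y0 r : measurable_fun setT (box_bump x0 y0 r).
Proof.
rewrite /box_bump; apply: measurable_maxr; first exact: measurable_cst.
apply: measurable_minr; first exact: measurable_cst.
apply: measurable_funB; first exact: measurable_cst.
apply: measurable_funM; last exact: measurable_cst.
by apply: measurable_maxr; apply: measurableT_comp => //; apply: measurable_funB;
  try exact: measurable_cst.
Qed.

Lemma continuous_box_bump x0 y0 r : continuous (box_bump x0 y0 r).
Proof.
move=> z.
have c1 : {for z, continuous (fun z : R * R => `|z.1 - x0| : R^o)}.
  by apply: cvg_norm; apply: cvgB; [exact: cvg_fst | exact: cvg_cst].
have c2 : {for z, continuous (fun z : R * R => `|z.2 - y0| : R^o)}.
  by apply: cvg_norm; apply: cvgB; [exact: cvg_snd | exact: cvg_cst].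
have c3 : {for z, continuous
    (fun z : R * R => 2 - Num.max `|z.1 - x0| `|z.2 - y0| / r : R^o)}.
  apply: cvgB; first exact: cvg_cst.
  by apply: cvgM; [exact: (continuous_max c1 c2) | exact: cvg_cst].
have cc (c : R) : {for z, continuous (fun=> c : R^o)} by exact: cvg_cst.
exact: (continuous_max (cc 0) (continuous_min (cc 1) c3)).
Qed.

Lemma box_bump_range x0 y0 r z : 0 <= box_bump x0 y0 r z <= 1.
Proof. by rewrite /box_bump le_max lexx/= ge_max ler01 ge_min lexx. Qed.

Lemma box_bump_box x0 y0 r z : 0 < r -> box x0 y0 r z -> box_bump x0 y0 r z = 1.
Proof.
move=> r0 [] /=; rewrite !in_itv/= -!ler_distl => zx zy.
rewrite /box_bump; have h : Num.max `|z.1 - x0| `|z.2 - y0| / r <= 1.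
  by rewrite ler_pdivrMr// mul1r ge_max zx zy.
rewrite min_l; first by rewrite max_r.
lra.
Qed.

Lemma box_bump_eq0 x0 y0 r z : 0 < r ->
  ~ (`|z.1 - x0| <= 2 * r /\ `|z.2 - y0| <= 2 * r) -> box_bump x0 y0 r z = 0.
Proof.
move=> r0 h; rewrite /box_bump max_l// ge_min; apply/orP; right.
rewrite subr_le0 ler_pdivlMr// le_max.
apply/negPn/negP; rewrite negb_or -!ltNge => /andP[/ltW ? /ltW ?].
exact: h.
Qed.

Lemma mu_box_le m x0 y0 r : 0 < r ->
  (m = 0)%N \/ 6 * r < gap * l ^+ m ->
  (mu (box x0 y0 r) <= (8 * r * (b / (b - 1)) * b^-1 ^+ m)%:E)%E.
Proof.
move=> r0 sep.
(* From time [N] on, [m] past digits exist and the influence of the initial [x] is below [r]. *)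
have [N [mN lN]] : exists N, (m <= N)%N /\ forall k, (N <= k)%N -> l ^+ k <= r.
  have : (fun k => l ^+ k) @ \oo --> (0 : R).
    by apply: cvg_expr; rewrite gtr0_norm.
  move/cvgr0Pnorm_le => /(_ _ r0)[N _ hN]; exists (maxn m N); rewrite leq_maxl.
  split=> // k; rewrite geq_max => /andP[_ Nk].
  by have := hN k Nk; rewrite ger0_norm// exprn_ge0// ltW.
have mQ := @measurable_Qsq R; have mB := measurable_box x0 y0 r.
have -> : mu (box x0 y0 r) = mu (box x0 y0 r `&` @Qsq R).
  have [_ [muQ _]] := mu_SRB.
  rewrite -[in LHS](setUIDK (box x0 y0 r) (@Qsq R)) measureU//.
  - rewrite [X in (_ + X)%E](_ : _ = 0%E) ?adde0//.
    apply: (subset_measure0 _ _ _ muQ) => //.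
    + exact: measurableD.
    + exact: measurableC.
  - exact: measurableI.
  - exact: measurableD.
  - by apply/seteqP; split => // z [[_ ?] [_ ?]].
rewrite -integral_indic//.
apply: (@le_trans _ _ (\int[mu]_(z in @Qsq R) (box_bump x0 y0 r z)%:E)%E).
  apply: ge0_le_integral => //.
  - exact/measurable_EFinP/measurable_indic.
  - apply/measurable_EFinP; apply: measurable_funTS; exact: measurable_box_bump.
  - move=> z _; rewrite lee_fin indicE.
    have /andP[h0 _] := box_bump_range x0 y0 r z.
    by case: (pselect (box x0 y0 r z)) => h; [rewrite box_bump_box// mem_set | rewrite memNset].
have K0 : 0 <= 8 * r * (b / (b - 1)) * b^-1 ^+ m.
  rewrite !mulr_ge0 ?exprn_ge0 ?invr_ge0 ?(ltW b_gt0) ?ltW//.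
  by rewrite subr_gt0.
apply: (SRB_integral_le (N := N) mu_SRB) => //.
- exact: continuous_box_bump.
- exact: measurable_box_bump.
- exact: box_bump_range.
move=> k Nk.
have mk := leq_trans mN Nk; have lk := lN _ Nk.
apply: le_trans (orbit_box_measure x0 y0 r0 mk lk sep).
have mY := measurable_orbit_box k x0 y0 r.
apply: (@le_trans _ _ (@leb2 R (`[0, 1[%classic `*` orbit_box k x0 y0 r))).
  rewrite /leb2; apply: ge0_integral_le_measure => //.
  - by apply: measurableX.
  - apply: measurable_funTS.
    exact: (measurableT_comp (measurable_box_bump x0 y0 r) (measurable_iter_Tbl b l k)).
  - by move=> z _; exact: box_bump_range.
  move=> z [z1 z2] nz; apply: box_bump_eq0 => // -[h1 h2]; apply: nz; split => /=.
    by rewrite in_itv.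
  move: h1 h2; rewrite iter_Tbl/= => h1 h2; split => //; split => //.
  have lz : 0 <= l ^+ k * z.1 <= l ^+ k.
    have /andP[z10 z11] := z1.
    rewrite mulr_ge0 ?exprn_ge0 ?(ltW l_gt0)//=.
    by rewrite ler_piMr ?exprn_ge0 ?(ltW l_gt0)// ltW.
  move: h1 lz; rewrite !ler_norml => /andP[? ?] /andP[? ?]; apply/andP; split; lra.
rewrite /leb2 product_measure1E//.
by rewrite /= lebesgue_measure_itv/= lte_fin ltr01 oppr0 adde0 mul1e.
Qed.

End MassBound.

(** * Hausdorff dimension of measures *)

Section Diameter.
Context {R : realType}.
Implicit Types (A U : set (R * R)) (z w : R * R).

Lemma edist_le_add z w : Defs.edist z w <= `|z.1 - w.1| + `|z.2 - w.2|.
Proof.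
rewrite /Defs.edist -[leRHS]ger0_norm ?addr_ge0// -sqrtr_sqr ler_sqrt ?sqr_ge0//.
rewrite [leRHS]sqrrD !real_normK ?num_real// addrAC lerDl mulrn_wge0//.
Qed.

Lemma le_edist1 z w : `|z.1 - w.1| <= Defs.edist z w.
Proof. by rewrite /Defs.edist -sqrtr_sqr ler_sqrt ?addr_ge0 ?sqr_ge0// lerDl sqr_ge0. Qed.

Lemma le_edist2 z w : `|z.2 - w.2| <= Defs.edist z w.
Proof. by rewrite /Defs.edist -sqrtr_sqr ler_sqrt ?addr_ge0 ?sqr_ge0// lerDr sqr_ge0. Qed.

Lemma diam_ge0 A : (0 <= diam A)%E.
Proof. by apply: ereal_sup_ubound; left. Qed.

Lemma diam_le A (r : R) : 0 <= r ->
  (forall z w, A z -> A w -> Defs.edist z w <= r) -> (diam A <= r%:E)%E.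
Proof.
move=> r0 h; apply: ge_ereal_sup => _ [->|[z Az [w Aw <-]]]; rewrite lee_fin//.
exact: h.
Qed.

Lemma diam_set0 : diam (set0 : set (R * R)) = 0%E.
Proof.
apply/eqP; rewrite eq_le diam_ge0 andbT.
by apply: diam_le => // z w [].
Qed.

Lemma edist_le_diam A (r : R) z w : (diam A <= r%:E)%E -> A z -> A w ->
  Defs.edist z w <= fine (diam A).
Proof.
move=> Ar Az Aw.
have fA : diam A \is a fin_num by rewrite ge0_fin_numE ?diam_ge0// (le_lt_trans Ar)// ltry.
rewrite -lee_fin fineK//; apply: ereal_sup_ubound; right.
by exists z => //; exists w.
Qed.

Lemma hausdorff_delta_ge0 (s delta : R) A : (0 <= hausdorff_delta s delta A)%E.
Proof.
apply: le_ereal_inf_tmp => _ [U _ <-]; apply: nneseries_ge0 => i _ _.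
by rewrite lee_fin powR_ge0.
Qed.

(** The list is continued by empty sets of diameter 0, whose [s]-th powers vanish because [0 < s];
    the power with exponent 0 would be 1. *)
Lemma hausdorff_delta_le_seq (s delta c : R) A (u : seq (set (R * R))) :
  0 < s -> 0 <= c -> c <= delta ->
  A `<=` [set z | exists2 U, U \in u & U z] ->
  (forall U, U \in u -> (diam U <= c%:E)%E) ->
  (hausdorff_delta s delta A <= ((size u)%:R * c `^ s)%:E)%E.
Proof.
move=> s0 c0 cd Au uc; pose V i := nth set0 u i.
have Vc i : (diam (V i) <= c%:E)%E.
  have [iu|iu] := ltnP i (size u); first exact/uc/mem_nth.
  by rewrite /V nth_default// diam_set0 lee_fin.
apply: (@le_trans _ _ (\sum_(0 <= i <oo) ((fine (diam (V i))) `^ s)%:E)%E).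
  apply: ereal_inf_lbound; exists V => //; split=> [z /Au[U Uu Uz]|i].
    by exists (index U u) => //; rewrite /V nth_index.
  by rewrite (le_trans (Vc i))// lee_fin.
apply: lime_le.
  by apply: is_cvg_nneseries => i _ _; rewrite lee_fin powR_ge0.
apply: nearW => n; rewrite big_mkord.
apply: (@le_trans _ _ (\sum_(i < n) ((i < size u)%N%:R * c `^ s)%:E)%E).
  apply: lee_sum => i _; rewrite lee_fin.
  have [iu|iu] := ltnP i (size u).
    rewrite mul1r ge0_ler_powR ?nnegrE ?fine_ge0 ?diam_ge0// ?(ltW s0)//.
    by rewrite -lee_fin fineK ?Vc// ge0_fin_numE ?diam_ge0// (le_lt_trans (Vc i))// ltry.
  by rewrite mul0r /V nth_default// diam_set0/= powR0// gt_eqF.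
rewrite sumEFin lee_fin -mulr_suml ler_wpM2r ?powR_ge0//.
by rewrite -natr_sum sum_lt_count ler_nat geq_minr.
Qed.

End Diameter.

Section DimensionLowerBound.
Context {R : realType}.
Variable mu : {measure set (R * R) -> \bar R}.

(** A covering set lies in the box centred at one of its points with its diameter as half-side.
    Diameters at most 1 let the exponent [s0] be lowered to [s], so a cover with small [s]-sum would
    give a set of full mass a mass below 1. *)
Lemma mass_distribution (C s0 : R) : 0 < C -> 0 < s0 -> mu setT = 1%E ->
  (forall x0 y0 r, 0 < r -> (mu (box x0 y0 r) <= (C * r `^ s0)%:E)%E) ->
  (s0%:E <= hausdorff_dim_measure mu)%E.
Proof.
move=> C0 s00 muT hC.
(* Covering sets of diameter 0 escape the hypothesis, which requires [0 < r]. Points are null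
   because the radius solving [C * r ^ s0 = e] gives mass at most [e]. *)
have box0 x0 y0 : mu (box x0 y0 0) = 0%E.
  apply/eqP; rewrite -measure_le0; apply/lee_addgt0Pr => e e0; rewrite add0e.
  pose r := (e / C) `^ s0^-1.
  have eC : 0 < e / C by rewrite divr_gt0.
  have r0 : 0 < r by rewrite powR_gt0.
  apply: (@le_trans _ _ (mu (box x0 y0 r))).
    apply: le_measure; rewrite ?inE; [exact: measurable_box|exact: measurable_box|].
    move=> z []; rewrite /= !in_itv/= !subr0 !addr0 => /andP[? ?] /andP[? ?].
    by split; rewrite /= in_itv/=; apply/andP; split; lra.
  apply: le_trans (hC _ _ _ r0) _.
  rewrite lee_fin /r -powRrM mulVf ?gt_eqF// powRr1; last exact: ltW.
  by rewrite mulrC divfK ?gt_eqF.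
apply: le_ereal_inf_tmp => _ [A [mA muA] <-].
apply: le_ereal_inf_tmp => _ [s [s_ge0 HsA] <-]; rewrite lee_fin leNgt; apply/negP => ss0.
have muA1 : mu A = 1%E.
  have -> : mu A = (mu A + mu (~` A))%E by rewrite muA adde0.
  rewrite -muT -(setUv A); apply: esym; apply: measureU => //.
  - exact: measurableC.
  - exact: setICr.
(* The threshold [C^-1] makes [C] times the [s]-sum of some cover fall below 1; the scale 1 ensures
   diameters at most 1. *)
have : (hausdorff_delta s 1 A < C^-1%:E)%E.
  apply: le_lt_trans (_ : _ <= 0)%E _; last by rewrite lte_fin invr_gt0.
  by rewrite -HsA; apply: ereal_sup_ubound; exists 1 => /=.
move=> /ereal_inf_lt[_ [U [AU Ud] <-]] ltC.
pose d i := fine (diam (U i)).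
pose z i := xget (0, 0) (U i).
pose B i := box (z i).1 (z i).2 (d i).
have d01 i : 0 <= d i <= 1.
  have fd : diam (U i) \is a fin_num.
    by rewrite ge0_fin_numE ?diam_ge0// (le_lt_trans (Ud i))// ltry.
  by rewrite -!lee_fin /d fineK// diam_ge0 Ud.
have muB i : (mu (B i) <= (C * d i `^ s)%:E)%E.
  have /andP[d0 d1] := d01 i.
  have [dz|dn0] := eqVneq (d i) 0.
    by rewrite /B dz box0 lee_fin mulr_ge0 ?powR_ge0// ltW.
  apply: le_trans (hC _ _ _ _) _; first by rewrite lt0r dn0.
  rewrite lee_fin ler_wpM2l ?(ltW C0)// ger_powR ?d1 ?lt0r ?dn0//.
    by rewrite d0.
  exact: ltW.
have AB : A `<=` \bigcup_i B i.
  move=> w /AU[i _ Uw]; exists i => //.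
  have Uz : U i (z i) by rewrite /z; apply: xgetPex; exists w.
  have dw := edist_le_diam (Ud i) Uw Uz.
  split; rewrite /= in_itv/= -ler_distl (le_trans _ dw)//.
    exact: le_edist1.
  exact: le_edist2.
have mB i : measurable (B i) by exact: measurable_box.
have := measure_sigma_subadditive mu mB mA AB.
rewrite muA1; apply/negP; rewrite -ltNge.
apply: (@le_lt_trans _ _ (\sum_(0 <= i <oo) (C * d i `^ s)%:E)%E).
  by apply: lee_nneseries => i *; [exact: measure_ge0 | exact: muB].
rewrite (eq_eseriesr (g := fun i => (C%:E * (d i `^ s)%:E)%E)); last first.
  by move=> i _; rewrite EFinM.
rewrite nneseriesZl; last by move=> i _; rewrite lee_fin powR_ge0.
by rewrite -lte_pdivlMl// mule1.
Qed.

End DimensionLowerBound.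

(** * Dimension of the limit measures *)

Section SRBDimension.
Context {R : realType}.
Variables (b l : R) (b_gt1 : 1 < b) (b_lt2 : b < 2) (l_gt0 : 0 < l) (l_lt1 : l < 1).

Let b_gt0 : 0 < b. Proof. exact: lt_trans b_gt1. Qed.

Definition entropy_ratio : R := ln b / ln l^-1.

Lemma ln_invl_gt0 : 0 < ln l^-1.
Proof. by rewrite ln_gt0// invf_gt1. Qed.

Lemma entropy_ratio_gt0 : 0 < entropy_ratio.
Proof. by rewrite divr_gt0 ?ln_invl_gt0// ln_gt0. Qed.

Lemma powR_entropy_ratio n : (l ^+ n) `^ entropy_ratio = b^-1 ^+ n.
Proof.
have l1 : l `^ entropy_ratio = b^-1.
  rewrite /powR gt_eqF// /entropy_ratio.
  rewrite (_ : _ * _ = - ln b) ?expRN ?lnK ?posrE//.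
  have := ln_invl_gt0; rewrite lnV ?posrE// => h.
  by field; rewrite -oppr_eq0 gt_eqF.
elim: n => [|n IH]; first by rewrite !expr0 powR1.
by rewrite exprS powRM ?exprn_ge0 ?(ltW l_gt0)// IH l1 exprS.
Qed.

Variables (mu : {measure set (R * R) -> \bar R}) (mu_SRB : is_SRB_limit b l mu).

Lemma SRB_dim_ge g : b <= g -> Sset g -> l < g^-1 ->
  ((1 + entropy_ratio)%:E <= hausdorff_dim_measure mu)%E.
Proof.
move=> bg gS lg; have gap0 := gap_gt0 b_gt1 bg lg.
have r0 := entropy_ratio_gt0; have [muT _] := mu_SRB.
(* The first part is the constant of [mu_box_le], the second bounds [b^-1 ^+ m]; its factor [b] is
   the price of stepping from the critical index [k] to [m = k - 1]. *)
pose C := 8 * (b / (b - 1)) * (b * (6 / gap l g) `^ entropy_ratio).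
have b1 : 0 < b / (b - 1) by rewrite divr_gt0// subr_gt0.
have s6 : 0 < 6 / gap l g by rewrite divr_gt0.
apply: (@mass_distribution _ _ C) => //.
- by apply: mulr_gt0 (mulr_gt0 _ b1) (mulr_gt0 b_gt0 (powR_gt0 _ s6)).
- lra.
move=> x0 y0 r rgt0.
suff [m [sep bm]] : exists m, ((m = 0)%N \/ 6 * r < gap l g * l ^+ m) /\
    b^-1 ^+ m <= b * (6 / gap l g * r) `^ entropy_ratio.
  apply: le_trans (mu_box_le b_gt1 b_lt2 bg gS l_gt0 lg mu_SRB x0 y0 rgt0 sep) _.
  rewrite lee_fin /C powRD; last by apply/implyP => _; rewrite gt_eqF.
  rewrite powRr1 ?(ltW rgt0)//.
  apply: (@le_trans _ _ (8 * r * (b / (b - 1)) * (b * (6 / gap l g * r) `^ entropy_ratio))).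
    rewrite ler_wpM2l//; apply: mulr_ge0 (ltW b1).
    by apply: mulr_ge0 (ltW rgt0).
  rewrite powRM ?(ltW s6) ?(ltW rgt0)//.
  by rewrite le_eqVlt; apply/orP; left; apply/eqP; ring.
have ex : exists k, gap l g * l ^+ k <= 6 * r.
  have : (fun k => l ^+ k) @ \oo --> (0 : R) by apply: cvg_expr; rewrite gtr0_norm.
  have e0 : 0 < 6 * r / gap l g by rewrite divr_gt0// mulr_gt0.
  move/cvgr0Pnorm_le => /(_ _ e0)[N _ hN]; exists N.
  have := hN N (leqnn N); rewrite ger0_norm ?exprn_ge0 ?(ltW l_gt0)//.
  by rewrite ler_pdivlMr// mulrC.
(* Minimality makes the separation condition hold strictly at [k - 1], while [l ^+ k] is already
   comparable to [r]. For [k = 0] the predecessor is 0, the case without separation. *)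
have [k hk kmin] := ex_minnP ex.
have lk : l ^+ k <= 6 / gap l g * r.
  by rewrite mulrAC ler_pdivlMr// mulrC.
have bk : b^-1 ^+ k <= (6 / gap l g * r) `^ entropy_ratio.
  rewrite -powR_entropy_ratio ge0_ler_powR ?nnegrE ?exprn_ge0 ?(ltW l_gt0) ?(ltW r0)//.
  by rewrite mulr_ge0 ?(ltW s6) ?(ltW rgt0).
exists k.-1; case: k hk kmin lk bk => [|k] hk kmin lk bk /=.
  split; first by left.
  by rewrite (le_trans bk)// ler_peMl ?powR_ge0// ltW.
split.
  by right; rewrite ltNge; apply/negP => /kmin; rewrite ltnn.
by rewrite -ler_pdivrMl// -exprS.
Qed.

(** A continuous stand-in for the indicator of the complement of the vertical strips around the
    pasts of length [m]: one factor per strip, zero on it. *)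
Definition attractor_fun m (z : R * R) : R :=
  \prod_(w <- words b m 1)
    Num.min 1 (Num.max 0 (`|z.1 - (1 - l) * past_word l w| - l ^+ m)).

Lemma attractor_fun_range m z : 0 <= attractor_fun m z <= 1.
Proof.
rewrite /attractor_fun; elim: words => [|w s IH].
  by rewrite big_nil ler01 lexx.
rewrite big_cons; have /andP[p0 p1] := IH; set q := Num.min _ _.
have q0 : 0 <= q by rewrite le_min ler01 le_max lexx.
have q1 : q <= 1 by rewrite ge_min lexx.
by rewrite mulr_ge0//= mulr_ile1.
Qed.

Lemma attractor_fun_eq0 m z : attractor_fun m z = 0 ->
  exists2 w, w \in words b m 1 & `|z.1 - (1 - l) * past_word l w| <= l ^+ m.
Proof.
rewrite /attractor_fun => /eqP; rewrite prodf_seq_eq0 => /hasP[w ws /= /eqP h].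
exists w => //; rewrite leNgt; apply/negP; rewrite -subr_gt0 => h'.
suff : 0 < 0 :> R by rewrite ltxx.
by rewrite -{2}h lt_min ltr01 lt_max h' orbT.
Qed.

(** The last [m] digits name the strip containing the point: its abscissa is the rescaled past plus
    [l ^+ m] times an abscissa in [[0, 1)]. *)
Lemma attractor_fun_orbit m k z : (m <= k)%N -> Qsq z ->
  attractor_fun m (iter k (Tbl b l) z) = 0.
Proof.
move=> mk Qz; set z' := iter (k - m) (Tbl b l) z.
have Qz' : Qsq z' by exact: iter_Tbl_Qsq.
rewrite -(subnK mk) addnC iterD -/z' iter_Tbl /attractor_fun.
apply/eqP; rewrite prodf_seq_eq0; apply/hasP.
have [/andP[x0 x1] y01] := Qz'.
exists (word b m z'.2); first exact: word_in_words.
apply/eqP => /=; rewrite -past_word_past addrK max_l ?min_r//.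
rewrite subr_le0 ger0_norm ?mulr_ge0 ?exprn_ge0 ?(ltW l_gt0)//.
by rewrite ler_piMr ?exprn_ge0 ?(ltW l_gt0)// ltW.
Qed.

Lemma measurable_attractor_fun m : measurable_fun setT (attractor_fun m).
Proof.
rewrite /attractor_fun; elim: words => [|w s IH].
  by under eq_fun do rewrite big_nil; exact: measurable_cst.
under eq_fun do rewrite big_cons.
apply: measurable_funM => //.
apply: measurable_minr; first exact: measurable_cst.
apply: measurable_maxr; first exact: measurable_cst.
apply: measurable_funB; last exact: measurable_cst.
apply: measurableT_comp => //; apply: measurable_funB; last exact: measurable_cst.
exact: measurable_fst.
Qed.

Lemma continuous_attractor_fun m : continuous (attractor_fun m).
Proof.
rewrite /attractor_fun; elim: words => [|w s IH] z.
  by under eq_fun do rewrite big_nil; exact: cvg_cst.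
under eq_fun do rewrite big_cons.
apply: cvgM; last exact: IH.
have c1 : {for z, continuous (fun z : R * R =>
    `|z.1 - (1 - l) * past_word l w| - l ^+ m : R^o)}.
  apply: cvgB; last exact: cvg_cst.
  by apply: cvg_norm; apply: cvgB; [exact: cvg_fst | exact: cvg_cst].
have cc (c : R) : {for z, continuous (fun=> c : R^o)} by exact: cvg_cst.
exact: (continuous_min (cc 1) (continuous_max (cc 0) c1)).
Qed.

Definition attractor : set (R * R) :=
  @Qsq R `&` \bigcap_m [set z | attractor_fun m z = 0].

Lemma measurable_attractor : measurable attractor.
Proof.
apply: measurableI; first exact: measurable_Qsq.
apply: bigcapT_measurable => m.
have := @measurable_attractor_fun m measurableT _ (measurable_set1 0).
by rewrite setTI.
Qed.

(** The orbit integrals of [attractor_fun m] vanish from time [m] on, hence so does its integral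
    against [mu]; being nonnegative, it is zero almost everywhere, for all [m] at once. *)
Lemma mu_attractorC : mu (~` attractor) = 0%E.
Proof.
have [muT [muQ _]] := mu_SRB; have mQ := @measurable_Qsq R.
apply: measure_negligible; first exact: measurableC measurable_attractor.
apply: (negligibleS (A := ~` @Qsq R `|`
    \bigcup_m ~` [set z | @Qsq R z -> attractor_fun m z = 0])).
  move=> z nA; apply: contrapT => /not_orP[/contrapT Qz nU]; apply: nA; split => //.
  by move=> m _; apply: contrapT => nm; apply: nU; exists m => // /(_ Qz).
apply: negligibleU.
  by apply/negligibleP => //; exact: measurableC.
apply: negligible_bigcup => m.
have int0 : (\int[mu]_(z in @Qsq R) (attractor_fun m z)%:E = 0)%E.
  apply/eqP; rewrite eq_le; apply/andP; split; last first.
    by apply: integral_ge0 => z _; rewrite lee_fin; have /andP[] := attractor_fun_range m z.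
  apply: (SRB_integral_le (N := m) mu_SRB) => //.
  - exact: continuous_attractor_fun.
  - exact: measurable_attractor_fun.
  - exact: attractor_fun_range.
  move=> k mk; rewrite integral0_eq// => z Qz.
  by rewrite attractor_fun_orbit.
have mf : measurable_fun (@Qsq R) (EFin \o attractor_fun m).
  by apply/measurable_EFinP; apply: measurable_funTS; exact: measurable_attractor_fun.
have [+ _] := ae_eq_integral_abs mu mQ mf.
have -> : (\int[mu]_(x in @Qsq R) `|(EFin \o attractor_fun m) x| = 0)%E.
  rewrite -int0; apply: eq_integral => z _ /=.
  by rewrite ger0_norm//; have /andP[] := attractor_fun_range m z.
move=> /(_ erefl); apply: negligibleS => z /= + h; apply => Qz.
by have := h Qz => /= -[].
Qed.

(** The strips are cut at height steps [l ^+ m]: at most [b / (b - 1) * b ^+ m] words times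
    [2 * l^-1 ^+ m] heights, with pieces of diameter at most [3 * l ^+ m]. The [s]-sum is bounded by
    [K * q ^+ m], and [q < 1] is exactly the assumption on [s]. *)
Lemma attractor_dim_le s : 1 + entropy_ratio < s ->
  hausdorff_measure s attractor = 0%E.
Proof.
move=> hs; have r0 := entropy_ratio_gt0; have s0 : 0 < s by lra.
suff h delta : 0 < delta -> hausdorff_delta s delta attractor = 0%E.
  apply/eqP; rewrite eq_le; apply/andP; split.
    by apply: ge_ereal_sup => _ [d /= d0 <-]; rewrite h.
  by apply: ereal_sup_ubound; exists 1 => //=; rewrite h.
move=> d0; apply/eqP; rewrite eq_le hausdorff_delta_ge0 andbT.
pose K := 2 * (b / (b - 1)) * 3 `^ s.
pose q := l `^ (s - 1 - entropy_ratio).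
have q0 : 0 < q by rewrite powR_gt0.
have q1 : q < 1.
  rewrite /q /powR gt_eqF// expR_lt1 pmulr_rlt0; last by rewrite !subr_gt0; lra.
  by rewrite ln_lt0// l_gt0.
have b1 : 0 < b / (b - 1) by rewrite divr_gt0// subr_gt0.
have K0 : 0 < K.
  by apply: mulr_gt0; [exact: mulr_gt0 | exact: powR_gt0].
have lm0 m : 0 < l ^+ m by rewrite exprn_gt0.
have main m : 3 * l ^+ m <= delta ->
    (hausdorff_delta s delta attractor <= (K * q ^+ m)%:E)%E.
  move=> md; pose J := (Num.truncn (l^-1 ^+ m)).+1.
  pose rect (w : seq bool) (j : nat) : set (R * R) := [set z |
    `|z.1 - (1 - l) * past_word l w| <= l ^+ m /\
    j%:R * l ^+ m <= z.2 <= (j%:R + 1) * l ^+ m].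
  pose u := [seq rect w j | w <- words b m 1, j <- iota 0 J].
  have := @hausdorff_delta_le_seq R s delta (3 * l ^+ m) attractor u s0 _ md.
  have l30 : 0 <= 3 * l ^+ m by rewrite mulr_ge0// ltW.
  move=> /(_ l30) h; apply: le_trans (h _ _) _.
  - move=> z [[_ /andP[y0 y1]] /(_ m I)/attractor_fun_eq0[w ws zw]].
    pose j := Num.truncn (z.2 / l ^+ m).
    have zl0 : 0 <= z.2 / l ^+ m by rewrite divr_ge0// ltW.
    exists (rect w j).
      apply/allpairsP; exists (w, j); split => //; change (j \in iota 0 J).
      rewrite mem_iota add0n ltnS /J le_truncn// -exprVn ler_piMl//.
      by rewrite exprn_ge0// invr_ge0 ltW.
      exact: ltW.
    split => //; have /andP[h1 h2] := truncn_itv zl0.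
    by rewrite -ler_pdivlMr// h1/= -ler_pdivrMr// natr1 ltW.
  - move=> U /allpairsP[[w j] [_ _ ->]] /=; apply: diam_le => // z z' [hz hz2] [hz' hz2'].
    apply: le_trans (edist_le_add _ _) _.
    have h1 : `|z.1 - z'.1| <= 2 * l ^+ m.
      by move: hz hz'; rewrite !ler_norml => /andP[? ?] /andP[? ?]; apply/andP; split; lra.
    have h2 : `|z.2 - z'.2| <= l ^+ m.
      by move: hz2 hz2'; rewrite !ler_norml => /andP[? ?] /andP[? ?]; apply/andP; split; lra.
    lra.
  rewrite lee_fin size_allpairs size_iota natrM.
  have hW := words_count b_gt1 b_lt2 m.
  have hJ : J%:R <= 2 * l^-1 ^+ m.
    have lm1 : 1 <= l^-1 ^+ m by rewrite exprn_ege1// invf_ge1// ltW.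
    rewrite /J -natr1; have /andP[] := truncn_itv (ltW (lt_le_trans ltr01 lm1)); lra.
  apply: (@le_trans _ _ (b / (b - 1) * b ^+ m * (2 * l^-1 ^+ m) * (3 * l ^+ m) `^ s)).
    by rewrite ler_wpM2r ?powR_ge0// ler_pM ?ler0n.
  rewrite powRM ?(ltW (lm0 m))//.
  have -> : (l ^+ m) `^ s = l ^+ m * b^-1 ^+ m * q ^+ m.
    have -> : q ^+ m = (l ^+ m) `^ (s - 1 - entropy_ratio).
      by rewrite -powR_mulrn ?powR_ge0// -powRrM mulrC powRrM powR_mulrn// ltW.
    rewrite -powR_entropy_ratio -{2}[l ^+ m]powRr1 ?(ltW (lm0 m))//.
    by rewrite -!powRD ?(gt_eqF (lm0 m)) ?implybT//; congr powR; ring.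
  rewrite le_eqVlt; apply/orP; left; apply/eqP; rewrite /K !exprVn; field.
  by rewrite !expf_neq0 ?gt_eqF// subr_gt0.
apply/lee_addgt0Pr => e e0; rewrite add0e.
have eK : 0 < e / K by rewrite divr_gt0.
have [m1 h1] : exists N, forall k, (N <= k)%N -> q ^+ k <= e / K.
  have : (fun k => q ^+ k) @ \oo --> (0 : R) by apply: cvg_expr; rewrite gtr0_norm.
  move/cvgr0Pnorm_le => /(_ _ eK)[N _ hN]; exists N => k /hN.
  by rewrite ger0_norm// exprn_ge0// ltW.
have d3 : 0 < delta / 3 by rewrite divr_gt0.
have [m2 h2] : exists N, forall k, (N <= k)%N -> l ^+ k <= delta / 3.
  have : (fun k => l ^+ k) @ \oo --> (0 : R) by apply: cvg_expr; rewrite gtr0_norm.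
  move/cvgr0Pnorm_le => /(_ _ d3)[N _ hN]; exists N => k /hN.
  by rewrite ger0_norm// ltW.
pose m := maxn m1 m2.
apply: le_trans (main m _) _.
  have := h2 m (leq_maxr _ _); lra.
by rewrite lee_fin mulrC -ler_pdivlMr// h1// leq_maxl.
Qed.

Lemma SRB_dim_le : (hausdorff_dim_measure mu <= (1 + entropy_ratio)%:E)%E.
Proof.
have r0 := entropy_ratio_gt0.
apply/lee_addgt0Pr => e e0; rewrite -EFinD.
apply: (@le_trans _ _ (hausdorff_dim attractor)).
  apply: ereal_inf_lbound; exists attractor => //; split.
    exact: measurable_attractor.
  exact: mu_attractorC.
apply: ereal_inf_lbound; exists (1 + entropy_ratio + e) => //; split; first by lra.
by apply: attractor_dim_le; lra.
Qed.

Lemma SRB_dim g : b <= g -> Sset g -> l < g^-1 ->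
  hausdorff_dim_measure mu = (1 + ln b / ln l^-1)%:E.
Proof.
move=> bg gS lg; apply/eqP; rewrite eq_le SRB_dim_le/=.
exact: (SRB_dim_ge bg gS lg).
Qed.

End SRBDimension.

(** * Affine changes of variables *)

Section AffineChangeOfVariables.
Context {R : realType}.

Lemma measurable_preimage d d' (T : measurableType d) (U : measurableType d')
    (f : T -> U) (A : set U) :
  measurable_fun setT f -> measurable A -> measurable (f @^-1` A).
Proof. by move=> mf mA; rewrite -[_ @^-1` _]setTI; exact: mf. Qed.

Variables (b c : R) (b_gt0 : 0 < b).

Definition affine_map (y : R) : R := b * y + c.

Lemma measurable_affine_map : measurable_fun [set: R] affine_map.
Proof.
apply: measurable_funD; last exact: measurable_cst.
by apply: measurable_funM => //; exact: measurable_cst.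
Qed.

(** The image measure scaled by [b] agrees with Lebesgue measure on half-open intervals, hence
    everywhere by uniqueness. *)
Lemma lebesgue_affine (A : set R) : measurable A ->
  @lebesgue_measure R (affine_map @^-1` A) = (b^-1%:E * lebesgue_measure A)%E.
Proof.
move=> mA.
pose k : {nonneg R} := NngNum (ltW b_gt0).
pose m : {measure set (measurableTypeR R) -> \bar R} :=
  measure_function_mscale__canonical__measure_function_Measure k
  (@measure_function_pushforward__canonical__measure_function_Measure
    _ _ (measurableTypeR R) (measurableTypeR R) _
    (@lebesgue_measure R) affine_map measurable_affine_map).
have h : forall X, ocitv X -> lebesgue_measure X = m X.
  move=> _ [[u v] _ <-]; rewrite /m /= /mscale /= /pushforward.
  have -> : affine_map @^-1` `]u, v]%classic =
      `](u - c) / b, (v - c) / b]%classic.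
    apply/seteqP; split => y; rewrite /= !in_itv/= /affine_map;
      by rewrite ltr_pdivrMr// ler_pdivlMr// ltrBlDr lerBrDr mulrC.
  rewrite !lebesgue_measure_itv/= !lte_fin ltr_pM2r ?invr_gt0// ltrD2r.
  case: ifP => _; last by rewrite mule0.
  rewrite -!EFinB -EFinM; congr EFin; field; exact: lt0r_neq0.
rewrite (lebesgue_measure_unique h mA) /m /= /mscale /= /pushforward.
by rewrite muleA -EFinM mulVf ?mul1e// gt_eqF.
Qed.

Lemma ge0_integral_affine (D : set R) (G : R -> \bar R) :
  measurable D -> measurable_fun D G -> (forall y, D y -> (0 <= G y)%E) ->
  (\int[lebesgue_measure]_(y in affine_map @^-1` D) G (affine_map y) =
   b^-1%:E * \int[lebesgue_measure]_(y in D) G y)%E.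
Proof.
move=> mD mG G0.
have bV0 : 0 <= b^-1 by rewrite invr_ge0 ltW.
pose k : {nonneg R} := NngNum bV0.
rewrite -(@ge0_integral_mscale _ _ _ lebesgue_measure D mD k G)//.
pose pf := @measure_function_pushforward__canonical__measure_function_Measure
  _ _ (measurableTypeR R) (measurableTypeR R) _ (@lebesgue_measure R)
  affine_map measurable_affine_map.
transitivity (\int[pf]_(y in D) G y)%E.
  have H0 : {in D, forall y, (0 <= G y)%E} by move=> y; rewrite inE; exact: G0.
  have H1 := @ge0_integral_pushforward _ _ (measurableTypeR R)
    (measurableTypeR R) R affine_map measurable_affine_map
    (@lebesgue_measure R) D G mD mG H0.
  by symmetry; refine (eq_trans H1 _).
refine (@eq_measure_integral _ (measurableTypeR R) R D
  (measure_function_mscale__canonical__measure_function_Measure k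
    (@lebesgue_measure R)) pf G _).
by move=> A mA _; rewrite /= /pushforward lebesgue_affine.
Qed.

End AffineChangeOfVariables.

(** * Renewal sequences *)

Section Renewal.
Context {R : realType}.
Variables (q M : R) (r u c : nat -> R).
Hypotheses (q_gt0 : 0 < q) (q_lt1 : q < 1) (M_ge0 : 0 <= M).
Hypotheses (r0 : r 0%N = 1) (r_ge0 : forall n, 0 <= r n) (r_le : forall n, r n <= q ^+ n).
Hypotheses (u_ge0 : forall n, 0 <= u n) (u_le : forall n, u n <= M).
Hypotheses (c_ge0 : forall n, 0 <= c n) (c_le : forall n, c n <= M * q ^+ n).
Hypothesis u_renewal : forall n,
  u n = \sum_(k < n) (r k - r k.+1) * u (n - k.+1)%N + c n.

(** With [r 0 = 1], the recursion says precisely that the convolution of [r] and [u] grows by [c n]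
    at step [n]. *)
Lemma renewal_convolution n : \sum_(j < n.+1) r j * u (n - j)%N = \sum_(k < n.+1) c k.
Proof.
elim: n => [|n IH].
  by rewrite !big_ord1 r0 mul1r subn0 u_renewal big_ord0 add0r.
rewrite big_ord_recl [RHS]big_ord_recr/= -IH r0 mul1r subn0 u_renewal.
rewrite [LHS]addrAC -big_split/=; congr (_ + _).
apply: eq_bigr => i _; rewrite /bump/= add1n subSS; ring.
Qed.

Let U n : R := \sum_(k < n) u k.

Lemma renewal_convolution_sum n :
  \sum_(j < n) r j * U (n - j) = \sum_(i < n) \sum_(k < i.+1) c k.
Proof.
elim: n => [|n IH]; first by rewrite !big_ord0.
rewrite [RHS]big_ord_recr/= -IH -renewal_convolution.
have -> : \sum_(j < n) r j * U (n - j) = \sum_(j < n.+1) r j * U (n - j).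
  by rewrite big_ord_recr/= subnn {3}/U big_ord0 mulr0 addr0.
rewrite -big_split/=; apply: eq_bigr => j _.
by rewrite -mulrDr /U subSn ?big_ord_recr// -ltnS.
Qed.

Lemma sum_natmul_expr n : \sum_(j < n) j%:R * q ^+ j <= q / (1 - q) ^+ 2.
Proof.
have q1 : 0 < 1 - q by rewrite subr_gt0.
suff -> : \sum_(j < n) j%:R * q ^+ j =
    q / (1 - q) ^+ 2 - n%:R * q ^+ n / (1 - q) - q ^+ n.+1 / (1 - q) ^+ 2.
  have h1 : 0 <= n%:R * q ^+ n / (1 - q).
    by apply: divr_ge0 (ltW q1); rewrite mulr_ge0 ?exprn_ge0// ltW.
  have h2 : 0 <= q ^+ n.+1 / (1 - q) ^+ 2.
    by apply: divr_ge0; apply: exprn_ge0; exact: ltW.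
  lra.
elim: n => [|n IH]; first by rewrite big_ord0 expr1 mul0r mul0r subr0 subrr.
rewrite big_ord_recr/= IH -natr1 !exprS; field.
by rewrite gt_eqF.
Qed.

Lemma U_sub_le n j : (j <= n)%N -> 0 <= U n - U (n - j) <= j%:R * M.
Proof.
elim: j => [|j IH] jn; first by rewrite subn0 subrr mul0r lexx.
have /andP[h1 h2] := IH (ltnW jn).
have eU : U (n - j) = U (n - j.+1) + u (n - j.+1).
  by rewrite -subnSK// /U big_ord_recr.
have := u_ge0 (n - j.+1); have := u_le (n - j.+1).
rewrite -natr1 mulrDl mul1r; move: h1 h2; rewrite eU => *.
by apply/andP; split; lra.
Qed.

Lemma is_cvg_series_le_geometric (v : nat -> R) K :
  (forall n, 0 <= v n) -> (forall n, v n <= K * q ^+ n) -> cvgn (series v).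
Proof.
move=> v0 vle; apply: (@series_le_cvg _ v (geometric K q)) => //.
- by move=> n; rewrite /= (le_trans (v0 n)).
- by apply: is_cvg_geometric_series; rewrite gtr0_norm.
Qed.

(* [u * r] is the partial sum of [c]; since [u] is bounded, averaging over [n]
   decouples the convolution. *)
Lemma renewal_average :
  (n%:R^-1 * \sum_(k < n) u k) @[n --> \oo] -->
  limn (series c) / limn (series r).
Proof.
have cr : cvgn (series r).
  by apply: (@is_cvg_series_le_geometric _ 1) => // n; rewrite mul1r.
have cc : cvgn (series c) by exact: (@is_cvg_series_le_geometric _ M).
have r1 n : 1 <= series r n.+1.
  rewrite /series/= big_mkord big_ord_recl r0 lerDl.
  by apply: sumr_ge0 => i _.
have limr1 : 1 <= limn (series r).
  by apply: limr_ge => //; exists 1%N => // -[|n] // _; exact: r1.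
pose C n := \sum_(i < n) \sum_(k < i.+1) c k.
have meanC : (n%:R^-1 * C n) @[n --> \oo] --> limn (series c).
  have h := @cesaro R (fun n => series c n.+1) (limn (series c)).
  rewrite -cvg_shiftS; apply: cvg_trans (h _); last by rewrite cvg_shiftS.
  apply: near_eq_cvg; near=> n.
  rewrite /arithmetic_mean /= /C /series/= big_mkord; congr (_ * _).
  by apply: eq_bigr => i _; rewrite big_mkord.
(* The cost of replacing [U (n - j)] by [U n]. Each difference is at most [j * M] and
   [r j <= q ^+ j], so [E] is bounded in [n] and disappears in the mean. *)
pose E n := \sum_(j < n) r j * (U n - U (n - j)).
have EC n : U n * series r n = C n + E n.
  rewrite /C -renewal_convolution_sum /E -big_split/= /series/= big_mkord mulr_sumr.
  by apply: eq_bigr => j _; ring.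
have E0 n : 0 <= E n <= M * (q / (1 - q) ^+ 2).
  apply/andP; split.
    apply: sumr_ge0 => j _; rewrite mulr_ge0//.
    by have /andP[] := U_sub_le (ltnW (ltn_ord j)).
  apply: (@le_trans _ _ (\sum_(j < n) M * (j%:R * q ^+ j))); last first.
    by rewrite -mulr_sumr ler_wpM2l// sum_natmul_expr.
  apply: ler_sum => j _; have /andP[h0 h1] := U_sub_le (ltnW (ltn_ord j)).
  by rewrite mulrA [_ * q ^+ _]mulrC [M * _]mulrC ler_pM.
have meanE : (n%:R^-1 * E n) @[n --> \oo] --> (0 : R).
  apply: (@squeeze_cvgr _ _ _ _ (fun=> 0) (fun n => n%:R^-1 * (M * (q / (1 - q) ^+ 2)))).
  - apply: nearW => n; have /andP[h0 h1] := E0 n.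
    by rewrite mulr_ge0 ?invr_ge0//= ler_wpM2l ?invr_ge0.
  - exact: cvg_cst.
  - rewrite -cvg_shiftS; set K := M * _.
    have h : harmonic n * K @[n --> \oo] --> (0 * K : R).
      by apply: cvgM; [exact: cvg_harmonic | exact: cvg_cst].
    by rewrite mul0r in h.
have {}meanE : n%:R^-1 * (C n + E n) / series r n @[n --> \oo] -->
    (limn (series c) + 0) / limn (series r).
  apply: cvgM; last by apply: cvgV cr; rewrite gt_eqF// (lt_le_trans ltr01).
  rewrite (_ : (fun n => _) = (fun n => n%:R^-1 * C n + n%:R^-1 * E n)).
    exact: cvgD.
  by apply/funext => n; rewrite mulrDr.
rewrite addr0 in meanE; apply: cvg_trans meanE; apply: near_eq_cvg.
exists 1%N => // -[//|n] _ /=.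
by rewrite -EC mulrA mulfK// gt_eqF// (lt_le_trans ltr01).
Unshelve. all: by end_near. Qed.

End Renewal.

(** * Averages along the beta-transformation *)

Section FoldMapAverage.
Context {R : realType}.
Variables (b : R) (b_gt1 : 1 < b) (b_lt2 : b < 2).

Let b_gt0 : 0 < b. Proof. exact: lt_trans b_gt1. Qed.
Let leb := @lebesgue_measure R.

(* Left-continuous orbit of 1: the fold map sends [0, top_orbit k) onto
   [0, top_orbit k.+1), covering [0, 1) once more when [1 < b * top_orbit k]. *)
Fixpoint top_orbit n : R :=
  if n is n'.+1 then b * top_orbit n' - (1 < b * top_orbit n')%R%:R else 1.

Lemma top_orbit_range n : 0 < top_orbit n <= 1.
Proof.
move: b_lt2 => b2; elim: n => [|n IH] /=; first by rewrite ltr01 lexx.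
have /andP[t0 t1] := IH.
have bt0 : 0 < b * top_orbit n by rewrite mulr_gt0.
have bt2 : b * top_orbit n <= b by rewrite ler_piMr// ltW.
by case: (ltP 1 (b * top_orbit n)) => h; rewrite ?mulr1n ?mulr0n; apply/andP; split; lra.
Qed.

(** Change of variables on the two affine branches: if [b * t > 1], the part below [b^-1] covers
    [[0, 1)] and the rest covers [[0, b * t - 1)]; otherwise only the first branch is met. *)
Lemma integral_fold_map (G : R -> \bar R) t : measurable_fun [set: R] G ->
  (forall y, 0 <= G y)%E -> 0 <= t <= 1 ->
  (\int[leb]_(y in `[0%R, t[) G (fold_map b y) =
   b^-1%:E * (((1 < b * t)%R%:R)%R%:E * \int[leb]_(y in `[0%R, 1%R[) G y +
              \int[leb]_(y in `[0%R, (b * t - (1 < b * t)%R%:R)%R[) G y))%E.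
Proof.
move=> mG G0 /andP[t0 t1].
have mGf : measurable_fun [set: R] (fun y => G (fold_map b y)).
  exact: (measurableT_comp mG (measurable_fold_map b)).
have branch (c s : R) : (\int[leb]_(y in affine_map b c @^-1` `[0%R, s[)
      G (affine_map b c y) = b^-1%:E * \int[leb]_(y in `[0%R, s[) G y)%E.
  rewrite /leb ge0_integral_affine//; exact: measurable_funTS.
have int_branch (A : set R) (c s : R) : A = affine_map b c @^-1` `[0, s[%classic ->
    (forall y, A y -> fold_map b y = affine_map b c y) ->
    (\int[leb]_(y in A) G (fold_map b y) = b^-1%:E * \int[leb]_(y in `[0%R, s[) G y)%E.
  move=> eA h; rewrite -(branch c s) -eA; apply: eq_integral => y.
  by rewrite inE => /h ->.
have bV0 : 0 < b^-1 by rewrite invr_gt0.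
case: ltP => bt; rewrite ?mulr1n ?mulr0n; last first.
  rewrite mul0e add0e subr0; apply: (int_branch _ 0).
    apply/seteqP; split => y; rewrite /= !in_itv/= /affine_map addr0 => /andP[h1 h2];
      move: h1 h2; by rewrite pmulr_rge0// ltr_pM2l// => -> ->.
  move=> y; rewrite /= in_itv/= => /andP[h1 h2].
  rewrite /affine_map /fold_map digitE// leNgt (lt_le_trans _ bt) ?subr0 ?addr0//.
  by rewrite ltr_pM2l.
have bt1 : b^-1 < t by rewrite -div1r ltr_pdivrMr// mulrC.
rewrite mul1e.
have -> : `[0, t[%classic = `[0, b^-1[%classic `|` `[b^-1, t[%classic.
  apply/seteqP; split => y; rewrite /= !in_itv/=.
    by move=> /andP[-> ->] /=; rewrite andbT; case: ltP => h; [left|right].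
  move=> [] /andP[h1 h2]; first by rewrite h1 (lt_trans h2).
  by rewrite h2 (le_trans _ h1)// ltW.
rewrite /leb ge0_integral_setU//=; last 2 first.
- exact: measurable_funTS.
- apply/disj_setPS => y; rewrite /= !in_itv/= => -[/andP[_ h1] /andP[h2 _]].
  by move: (lt_le_trans h1 h2); rewrite ltxx.
have I0 s : (0 <= \int[leb]_(y in `[0%R, s[) G y)%E.
  by apply: integral_ge0 => y _; exact: G0.
rewrite (ge0_muleDr _ (I0 1) (I0 (b * t - 1))); congr (_ + _)%E.
  apply: (int_branch _ 0).
    apply/seteqP; split => y; rewrite /= !in_itv/= /affine_map addr0
      pmulr_rge0//.
      by rewrite -ltr_pdivlMl// mulr1.
    by rewrite -ltr_pdivlMl// mulr1.
  move=> y; rewrite /= in_itv/= => /andP[h1 h2].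
  by rewrite /affine_map /fold_map /digit leNgt h2 subr0 addr0.
apply: (int_branch _ (-1)).
  apply/seteqP; split => y; rewrite /= !in_itv/= /affine_map;
    rewrite subr_ge0 ltrD2r ltr_pM2l// -ler_pdivrMl// mulr1//.
move=> y; rewrite /= in_itv/= => /andP[h1 h2].
by rewrite /affine_map /fold_map digitE// -ler_pdivrMl// mulr1 h1 mulr1n.
Qed.

(** The integral of the [n]-th term of the invariant density. Successive differences are the digits
    of 1 weighted by powers of [b^-1], which makes this the sequence [r] of the renewal section. *)
Definition parry_weight n : R := b^-1 ^+ n * top_orbit n.

Lemma parry_weight_ge0 n : 0 <= parry_weight n.
Proof.
have /andP[t0 t1] := top_orbit_range n.
by rewrite mulr_ge0 ?exprn_ge0 ?invr_ge0 ?ltW.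
Qed.

Lemma parry_weight_le n : parry_weight n <= b^-1 ^+ n.
Proof.
have /andP[t0 t1] := top_orbit_range n.
by rewrite ler_piMr// exprn_ge0// invr_ge0 ltW.
Qed.

Lemma parry_weight_sub k :
  parry_weight k - parry_weight k.+1 = b^-1 ^+ k.+1 * (1 < b * top_orbit k)%R%:R.
Proof.
rewrite /parry_weight /= !exprS; field; exact: lt0r_neq0.
Qed.

Variables (F : R -> R) (M : R).
Hypotheses (mF : measurable_fun [set: R] F) (F_range : forall y, 0 <= F y <= M).

Let M_ge0 : 0 <= M.
Proof. by have /andP[h1 h2] := F_range 0; exact: le_trans h2. Qed.

Definition orbit_integral n (t : R) : R :=
  fine (\int[leb]_(y in `[0%R, t[) (F (iter n (fold_map b) y))%:E)%E.

Lemma orbit_integralE n t :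
  (\int[leb]_(y in `[0%R, t[) (F (iter n (fold_map b) y))%:E = (orbit_integral n t)%:E)%E.
Proof.
rewrite fineK// ge0_fin_numE; last first.
  by apply: integral_ge0 => y _; rewrite lee_fin; have /andP[] := F_range (iter n (fold_map b) y).
apply: (@le_lt_trans _ _ (\int[leb]_(y in `[0%R, t[) (cst M%:E y))%E).
  apply: ge0_le_integral => //.
  - by move=> y _; rewrite lee_fin; have /andP[] := F_range (iter n (fold_map b) y).
  - apply/measurable_EFinP; apply: measurable_funTS.
    exact: (measurableT_comp mF (measurable_iter n (measurable_fold_map b))).
  - by move=> y _; rewrite lee_fin; have /andP[] := F_range (iter n (fold_map b) y).
rewrite integral_cst//= /leb lebesgue_measure_itv/=.
by case: ifP => _; rewrite ?mule0 ?ltry// -EFinB -EFinM ltry.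
Qed.

Lemma orbit_integral_range n t : 0 <= t -> 0 <= orbit_integral n t <= M * t.
Proof.
move=> t0; rewrite -!lee_fin -orbit_integralE; apply/andP; split.
  by apply: integral_ge0 => y _; rewrite lee_fin; have /andP[] := F_range (iter n (fold_map b) y).
apply: (@le_trans _ _ (\int[leb]_(y in `[0%R, t[) (cst M%:E y))%E).
  apply: ge0_le_integral => //.
  - by move=> y _; rewrite lee_fin; have /andP[] := F_range (iter n (fold_map b) y).
  - apply/measurable_EFinP; apply: measurable_funTS.
    exact: (measurableT_comp mF (measurable_iter n (measurable_fold_map b))).
  - by move=> y _; rewrite lee_fin; have /andP[] := F_range (iter n (fold_map b) y).
rewrite integral_cst//= /leb lebesgue_measure_itv/= lte_fin.
case: ltP => h; first by rewrite -EFinB -EFinM subr0.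
by rewrite mule0 lee_fin mulr_ge0.
Qed.

Lemma orbit_integral_succ n k :
  orbit_integral n.+1 (top_orbit k) =
  b^-1 * ((1 < b * top_orbit k)%R%:R * orbit_integral n 1
          + orbit_integral n (top_orbit k.+1)).
Proof.
have /andP[t0 t1] := top_orbit_range k.
apply: EFin_inj; rewrite -orbit_integralE.
under eq_integral do rewrite iterSr.
rewrite (@integral_fold_map (fun y => (F (iter n (fold_map b) y))%:E)).
- rewrite -/(top_orbit k.+1) (orbit_integralE n 1) (orbit_integralE n (top_orbit k.+1)).
  by rewrite EFinM EFinD EFinM.
- apply/measurable_EFinP.
  exact: (measurableT_comp mF (measurable_iter n (measurable_fold_map b))).
- by move=> y; rewrite lee_fin; have /andP[] := F_range (iter n (fold_map b) y).
- by rewrite ltW.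
Qed.

(** Repeated unfolding of [orbit_integral_succ]: each full branch leaves an integral over [[0, 1)],
    and the truncated interval is carried along as last term. For [n = 0] this is the renewal
    equation. *)
Lemma orbit_integral_renewal n m : orbit_integral (n + m) 1 =
  \sum_(k < m) (parry_weight k - parry_weight k.+1) * orbit_integral (n + m - k.+1) 1
  + b^-1 ^+ m * orbit_integral n (top_orbit m).
Proof.
elim: m n => [|m IH] n; first by rewrite big_ord0 expr0 mul1r add0r addn0.
rewrite -addSnnS IH big_ord_recr/= -addrA; congr (_ + _).
rewrite orbit_integral_succ parry_weight_sub addSn subSS addnK exprS; ring.
Qed.

(** The limit is the integral of [F] against the normalised invariant density, integrated term by
    term. *)
Lemma fold_map_average :
  (n%:R^-1 * \sum_(k < n) orbit_integral k 1) @[n --> \oo] -->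
  limn (series (fun k => b^-1 ^+ k * orbit_integral 0 (top_orbit k)))
  / limn (series parry_weight).
Proof.
have bV0 : 0 < b^-1 by rewrite invr_gt0.
apply: (@renewal_average _ b^-1 M parry_weight (fun k => orbit_integral k 1)
  (fun k => b^-1 ^+ k * orbit_integral 0 (top_orbit k))) => //.
- by rewrite invf_lt1.
- by rewrite /parry_weight expr0 mul1r.
- exact: parry_weight_ge0.
- exact: parry_weight_le.
- by move=> n; have /andP[] := orbit_integral_range n ler01.
- by move=> n; have /andP[_] := orbit_integral_range n ler01; rewrite mulr1.
- move=> n; have /andP[t0 t1] := top_orbit_range n.
  have /andP[h _] := orbit_integral_range 0 (ltW t0).
  by rewrite mulr_ge0// exprn_ge0// ltW.
- move=> n; have /andP[t0 t1] := top_orbit_range n.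
  have /andP[h h'] := orbit_integral_range 0 (ltW t0).
  rewrite mulrC ler_wpM2r ?exprn_ge0 ?(ltW bV0)// (le_trans h')//.
  by rewrite ler_piMr.
- by move=> n; have := orbit_integral_renewal 0 n; rewrite add0n.
Qed.

End FoldMapAverage.

(** * The natural extension *)

Section NaturalExtension.
Context {R : realType}.
Variables (b : R) (b_gt1 : 1 < b) (b_lt2 : b < 2).

Let b_gt0 : 0 < b. Proof. exact: lt_trans b_gt1. Qed.
Let bV_gt0 : 0 < b^-1. Proof. by rewrite invr_gt0. Qed.
Let leb := @lebesgue_measure R.

Definition density_term (y : R) k : R := b^-1 ^+ k * (y < top_orbit b k)%R%:R.

Definition parry_density (y : R) : R := limn (series (density_term y)).

Lemma density_term_ge0 y k : 0 <= density_term y k.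
Proof. by rewrite mulr_ge0// exprn_ge0// ltW. Qed.

Lemma is_cvg_density y : cvgn (series (density_term y)).
Proof.
apply: (@is_cvg_series_le_geometric _ b^-1 _ _ _ 1) => //.
- by rewrite invf_lt1.
- exact: density_term_ge0.
- move=> k; rewrite mul1r ler_piMr ?exprn_ge0 ?(ltW bV_gt0)//.
  by case: (_ < _).
Qed.

Lemma parry_density_ge0 y : 0 <= parry_density y.
Proof.
apply: limr_ge; first exact: is_cvg_density.
by apply: nearW => n; apply: sumr_ge0 => k _; exact: density_term_ge0.
Qed.

Lemma parry_density_eq0 y : 1 <= y -> parry_density y = 0.
Proof.
move=> y1; rewrite /parry_density; have -> : density_term y = fun=> 0.
  apply/funext => k; rewrite /density_term ltNge.
  have /andP[_ tk] := top_orbit_range b_gt1 b_lt2 k.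
  by rewrite (le_trans tk y1) mulr0.
rewrite (_ : series _ = fun=> 0) ?lim_cst//.
by apply/funext => n; rewrite /series/= big1.
Qed.

Lemma measurable_density_term k : measurable_fun [set: R] (density_term ^~ k).
Proof.
apply: measurable_funM; first exact: measurable_cst.
by apply: measurable_bool_natr; apply: measurable_fun_ltr => //; exact: measurable_cst.
Qed.

Lemma measurable_parry_density : measurable_fun [set: R] parry_density.
Proof.
apply: (@measurable_fun_cvg _ _ _ _ (fun n y => series (density_term y) n)).
  move=> n; apply: measurable_sum => k; exact: measurable_density_term.
by move=> y _; exact: is_cvg_density.
Qed.

Lemma EFin_parry_density y :
  ((parry_density y)%:E = \sum_(0 <= k <oo) (density_term y k)%:E)%E.
Proof.
rewrite /parry_density -EFin_lim; last exact: is_cvg_density.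
by congr (limn _); apply/funext => n /=; rewrite /series/= sumEFin.
Qed.

(** If [1 < b * top_orbit b k], then [y / b] always lies below [top_orbit b k], and [(y + 1) / b]
    does so exactly when [y < top_orbit b k.+1]; otherwise [(y + 1) / b] never does. The weight
    difference is the share of the full branch. *)
Lemma density_term_split y k : 0 <= y < 1 ->
  b^-1 * (density_term (y / b) k + density_term ((y + 1) / b) k) =
  parry_weight b k - parry_weight b k.+1 + density_term y k.+1.
Proof.
move=> /andP[y0 y1]; rewrite parry_weight_sub// /density_term !exprS.
have -> : (y / b < top_orbit b k) = (y < b * top_orbit b k).
  by rewrite ltr_pdivrMr// mulrC.
have -> : ((y + 1) / b < top_orbit b k) = (y + 1 < b * top_orbit b k).
  by rewrite ltr_pdivrMr// mulrC.
rewrite [top_orbit b k.+1]/= -mulrDr -mulrDr mulrA; congr (_ * _).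
case: (ltP 1 (b * top_orbit b k)) => h; rewrite ?mulr1n ?mulr0n.
  by rewrite (lt_trans y1 h) ltrBrDr.
rewrite subr0 add0r [y + 1 < _]ltNge (le_trans h) ?mulr0n ?addr0//.
by rewrite lerDr.
Qed.

(** The density is fixed by the transfer operator. Summing over [k], the weight differences
    telescope to 1, which is the missing term of index 0 at [y < 1]. *)
Lemma parry_density_split y : 0 <= y < 1 ->
  parry_density y = b^-1 * (parry_density (y / b) + parry_density ((y + 1) / b)).
Proof.
move=> y01.
pose s n (x : R) := series (density_term x) n.
have e n : b^-1 * (s n (y / b) + s n ((y + 1) / b)) = s n.+1 y - parry_weight b n.
  have s0 x : s 0%N x = 0 by rewrite /s /series/= big_geq.
  have sS m x : s m.+1 x = s m x + density_term x m.
    by rewrite /s /series/= big_nat_recr.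
  elim: n => [|n IH].
    rewrite sS !s0 addr0 mulr0 add0r /density_term /parry_weight.
    by have /andP[_ ->] := y01; rewrite expr0 !mulr1 subrr.
  rewrite !(sS n) addrACA mulrDr IH density_term_split// (sS n.+1); ring.
have h1 : b^-1 * (s n (y / b) + s n ((y + 1) / b)) @[n --> \oo] -->
    b^-1 * (parry_density (y / b) + parry_density ((y + 1) / b)).
  by apply: cvgM; [exact: cvg_cst | apply: cvgD; exact: is_cvg_density].
have h2 : b^-1 * (s n (y / b) + s n ((y + 1) / b)) @[n --> \oo] --> parry_density y.
  rewrite (_ : (fun n => _) = (fun n => s n.+1 y - parry_weight b n)); last first.
    by apply/funext => n; exact: e.
  suff : s n.+1 y - parry_weight b n @[n --> \oo] --> parry_density y - 0.
    by rewrite subr0.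
  apply: cvgB; first by rewrite (cvg_shiftS (s ^~ y)); exact: is_cvg_density.
  apply: (@squeeze_cvgr _ _ _ _ (fun=> 0) (fun n => b^-1 ^+ n)).
  - by apply: nearW => n; rewrite parry_weight_ge0// parry_weight_le.
  - exact: cvg_cst.
  - by apply: cvg_expr; rewrite gtr0_norm// invf_lt1.
by rewrite -(cvg_lim _ h1)// -(cvg_lim _ h2).
Qed.

Definition ext_domain : set (R * R) :=
  [set w | 0 <= w.1 < 1 /\ 0 <= w.2 < parry_density w.1].

(** By [parry_density_split] the fibre over [y] cuts at this height into two pieces which, stretched
    by [b], are the fibres over [y / b] and [(y + 1) / b]. *)
Definition ext_digit (w : R * R) : bool := b^-1 * parry_density (w.1 / b) <= w.2.

(* Backward natural extension: a piecewise affine area-preserving bijection of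
   [ext_domain] whose digits code a past of the first coordinate. *)
Definition ext_back (w : R * R) : R * R :=
  if ext_digit w then ((w.1 + 1) / b, b * w.2 - parry_density (w.1 / b))
  else (w.1 / b, b * w.2).

Lemma measurable_density_fst : measurable_fun [set: R * R]
  (fun w => parry_density (w.1 / b)).
Proof.
apply: (measurableT_comp measurable_parry_density).
by apply: measurable_funM; [exact: measurable_fst | exact: measurable_cst].
Qed.

Lemma measurable_ext_digit : measurable_fun [set: R * R] ext_digit.
Proof.
apply: measurable_fun_ler; last exact: measurable_snd.
by apply: measurable_funM; [exact: measurable_cst | exact: measurable_density_fst].
Qed.

Lemma measurable_ext_back : measurable_fun [set: R * R] ext_back.
Proof.
apply: measurable_fun_ifT; first exact: measurable_ext_digit.
  apply: measurable_fun_pair.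
    apply: measurable_funM; last exact: measurable_cst.
    by apply: measurable_funD; [exact: measurable_fst | exact: measurable_cst].
  apply: measurable_funB; last exact: measurable_density_fst.
  by apply: measurable_funM; [exact: measurable_cst | exact: measurable_snd].
apply: measurable_fun_pair; apply: measurable_funM; try exact: measurable_cst.
  exact: measurable_fst.
exact: measurable_snd.
Qed.

Lemma measurable_ext_domain : measurable ext_domain.
Proof.
have mle (f g : R * R -> R) : measurable_fun setT f -> measurable_fun setT g ->
    measurable [set w | f w <= g w].
  by move=> mf mg; rewrite -[X in measurable X]setTI; exact: measurable_fun_le.
have mlt (f g : R * R -> R) : measurable_fun setT f -> measurable_fun setT g ->
    measurable [set w | f w < g w].
  move=> mf mg; rewrite (_ : mkset _ = ~` [set w | g w <= f w]).
    by apply: measurableC; exact: mle.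
  by apply/seteqP; split => w /=; [move=> h; apply/negP; rewrite -ltNge
    | move=> /negP; rewrite -ltNge].
rewrite (_ : ext_domain = ([set w | 0 <= w.1] `&` [set w | w.1 < 1]) `&`
    ([set w | 0 <= w.2] `&` [set w | w.2 < parry_density w.1])); last first.
  apply/seteqP; split => w.
    by move=> [/andP[? ?] /andP[? ?]].
  by move=> [[h1 h2] [h3 h4]]; split; apply/andP; split; [exact: h1|exact: h2|exact: h3|exact: h4].
apply: measurableI; apply: measurableI.
- by apply: mle; [exact: measurable_cst | exact: measurable_fst].
- by apply: mlt; [exact: measurable_fst | exact: measurable_cst].
- by apply: mle; [exact: measurable_cst | exact: measurable_snd].
- apply: mlt; first exact: measurable_snd.
  exact: (measurableT_comp measurable_parry_density measurable_fst).
Qed.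

Lemma ext_back_domain w : ext_domain w -> ext_domain (ext_back w).
Proof.
move=> [y01 /andP[v0 vh]]; have /andP[y0 y1] := y01.
rewrite /ext_back; case: ifPn => e.
  have hv : b * w.2 - parry_density (w.1 / b) < parry_density ((w.1 + 1) / b).
    by move: vh; rewrite parry_density_split// ltr_pdivlMl// ltrBlDr addrC.
  have h0 : 0 <= b * w.2 - parry_density (w.1 / b).
    by rewrite subr_ge0 -ler_pdivrMl.
  split => /=; last by rewrite h0 hv.
  (* If [(w.1 + 1) / b] reached 1, the density there would be 0 and the upper piece of the fibre
     empty. *)
  rewrite divr_ge0 ?addr_ge0 ?(ltW b_gt0)//= ltNge; apply/negP.
  by move=> /parry_density_eq0 hz; move: (le_lt_trans h0 hv); rewrite hz ltxx.
move: e; rewrite /ext_digit -ltNge => e.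
split => /=; last by rewrite mulr_ge0 ?(ltW b_gt0)//= -ltr_pdivlMl.
rewrite divr_ge0 ?(ltW b_gt0)//= ltr_pdivrMr// mul1r.
exact: lt_trans b_gt1.
Qed.

Lemma ext_back_fold w : ext_domain w ->
  digit b (ext_back w).1 = ext_digit w /\ fold_map b (ext_back w).1 = w.1.
Proof.
move=> [/andP[y0 y1] _].
suff h : digit b (ext_back w).1 = ext_digit w.
  split => //; rewrite /fold_map h /ext_back.
  by case: ext_digit => /=; field; exact: lt0r_neq0.
rewrite digitE// /ext_back; case: ifPn => e /=.
  by rewrite mulrC divfK ?gt_eqF// lerDr.
by rewrite mulrC divfK ?gt_eqF// leNgt y1.
Qed.

End NaturalExtension.

(** * Area preservation *)

Section AreaPreservation.
Context {R : realType}.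
Variables (b : R) (b_gt1 : 1 < b) (b_lt2 : b < 2).

Let b_gt0 : 0 < b. Proof. exact: lt_trans b_gt1. Qed.
Let bV_gt0 : 0 < b^-1. Proof. by rewrite invr_gt0. Qed.
Let leb := @lebesgue_measure R.
Notation D := (ext_domain b).
Notation S := (ext_back b).

Lemma integral_support d (T : measurableType d) (mu : {measure set T -> \bar R})
    (A : set T) (f : T -> \bar R) : (forall x, ~ A x -> f x = 0%E) ->
  (\int[mu]_x f x = \int[mu]_(x in A) f x)%E.
Proof.
move=> f0; rewrite [RHS]integral_mkcond; congr (integral _ _ _).
apply/funext => x; rewrite patchE; case: ifPn => //.
by rewrite notin_setE => /f0.
Qed.

Definition ext_section (E : set (R * R)) (y : R) : set R :=
  [set v | E (y, v) /\ 0 <= v < parry_density b y].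

Lemma xsection_ext_domain E y : 0 <= y < 1 ->
  xsection (E `&` D) y = ext_section E y.
Proof.
move=> y01; apply/seteqP; split => v; first by move=> /xsectionP[Ev [_ hv]].
by move=> [Ev hv]; apply/xsectionP.
Qed.

Lemma xsection_ext_domain_eq0 E y : ~ (0 <= y < 1) -> xsection (E `&` D) y = set0.
Proof. by move=> y01; apply/seteqP; split => v // /xsectionP[_ []]. Qed.

Lemma measurable_ext_section E y : measurable E -> measurable (ext_section E y).
Proof.
move=> mE; rewrite /ext_section.
rewrite [X in measurable X](_ : _ = xsection E y `&` `[0, parry_density b y[%classic).
  by apply: measurableI; [exact: measurable_xsection | exact: measurable_itv].
apply/seteqP; split => v /=; rewrite in_itv/= => -[h1 h2]; split => //.
  exact/xsectionP.
by move/xsectionP: h1.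
Qed.

Lemma ext_back_section E y : 0 <= y < 1 ->
  ext_section (S @^-1` E) y =
  affine_map b 0 @^-1` ext_section E (y / b) `|`
  affine_map b (- parry_density b (y / b)) @^-1` ext_section E ((y + 1) / b).
Proof.
move=> y01; rewrite /ext_section /affine_map.
apply/seteqP; split => v /=.
  rewrite /ext_back => -[Ev /andP[v0 vh]]; move: Ev; rewrite /ext_digit /=; case: ifPn => e Ev.
    right; split => //; rewrite subr_ge0 -ler_pdivrMl// e /=.
    by move: vh; rewrite parry_density_split// ltr_pdivlMl// ltrBlDr addrC.
  left; rewrite addr0; split => //; rewrite mulr_ge0 ?(ltW b_gt0)//=.
  by move: e; rewrite -ltNge ltr_pdivlMl.
rewrite /ext_back /ext_digit /= (parry_density_split b_gt1 b_lt2 y01) addr0 => -[].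
  move=> [Ev /andP[v0 vh]]; move: v0 vh; rewrite pmulr_rge0// => v0 vh.
  rewrite leNgt ltr_pdivlMl// vh /=; split => //; rewrite v0 ltr_pdivlMl//=.
  by rewrite (lt_le_trans vh)// lerDl parry_density_ge0.
move=> [Ev /andP[v0 vh]]; move: v0 vh; rewrite subr_ge0 => v0 vh.
rewrite ler_pdivrMl// v0; split => //; rewrite ltr_pdivlMl// -ltrBlDl vh andbT.
by rewrite -(pmulr_rge0 _ b_gt0) (le_trans _ v0)// parry_density_ge0.
Qed.

Lemma lebesgue_ext_back_section E y : measurable E -> 0 <= y < 1 ->
  (leb (ext_section (S @^-1` E) y) =
   b^-1%:E * (leb (ext_section E (y / b)) + leb (ext_section E ((y + 1) / b))))%E.
Proof.
move=> mE y01; rewrite ext_back_section// /leb measureU.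
- rewrite (ge0_muleDr _ (measure_ge0 _ _) (measure_ge0 _ _)).
  by congr adde; apply: lebesgue_affine => //; exact: measurable_ext_section.
- exact: measurable_preimage (@measurable_affine_map _ _ _) (measurable_ext_section _ mE).
- exact: measurable_preimage (@measurable_affine_map _ _ _) (measurable_ext_section _ mE).
apply/seteqP; split => v //; rewrite /affine_map => -[[_ /= /andP[_ h1]] [_ /andP[h2 _]]].
by move: h1 h2; rewrite addr0 subr_ge0 => h1 /(lt_le_trans h1); rewrite ltxx.
Qed.

(** Fibres are stretched by [b] and the base is contracted by [b]. The base points [y / b] and
    [(y + 1) / b] sweep [[0, 2 / b)], which contains [[0, 1)] since [b < 2]; beyond 1 the fibres are
    empty. *)
Lemma leb2_ext_back E : measurable E ->
  @leb2 R (S @^-1` E `&` D) = @leb2 R (E `&` D).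
Proof.
move=> mE; have mD := measurable_ext_domain b_gt1.
have mED : measurable (E `&` D) by exact: measurableI.
pose G y := leb (xsection (E `&` D) y).
have mG : measurable_fun [set: R] G.
  exact: (@measurable_fun_xsection _ _ (measurableTypeR R) (measurableTypeR R) R
    (@lebesgue_measure R) (E `&` D) mED).
have G0 y : (0 <= G y)%E by exact: measure_ge0.
have Gout y : ~ (`[0, 1[%classic y) -> G y = 0%E.
  by move=> /= y01; rewrite /G xsection_ext_domain_eq0 ?measure0// => h; apply: y01; rewrite in_itv.
have GE y : 0 <= y -> G y = leb (ext_section E y).
  move=> y0; have [y1|y1] := ltP y 1; first by rewrite /G xsection_ext_domain ?y0.
  rewrite /G xsection_ext_domain_eq0; last by rewrite ltNge y1 andbF.
  rewrite (_ : ext_section E y = set0)//; apply/seteqP; split => v // [_].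
  by rewrite parry_density_eq0// => /andP[h1 /(le_lt_trans h1)]; rewrite ltxx.
have -> : @leb2 R (S @^-1` E `&` D) = (\int[leb]_(y in `[0%R, 1%R[)
    (b^-1%:E * (G (affine_map b^-1 0 y) + G (affine_map b^-1 b^-1 y))))%E.
  rewrite /leb2 /product_measure1 (@integral_support _ (measurableTypeR R) _ (`[(0 : R), 1[%classic : set R)); last first.
    by move=> y /=; rewrite in_itv/= => y01; rewrite xsection_ext_domain_eq0 ?measure0.
  apply: eq_integral => y; rewrite inE /= in_itv/= => y01; have /andP[y0 y1] := y01.
  transitivity (leb (ext_section (S @^-1` E) y)); first by rewrite xsection_ext_domain.
  rewrite lebesgue_ext_back_section// /affine_map.
  have -> : b^-1 * y + 0 = y / b by rewrite addr0 mulrC.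
  have -> : b^-1 * y + b^-1 = (y + 1) / b by rewrite mulrDl mul1r mulrC.
  by rewrite !GE// divr_ge0 ?addr_ge0// ltW.
have mGa c : measurable_fun [set: R] (fun y => G (affine_map b^-1 c y)).
  exact: (measurableT_comp mG (@measurable_affine_map _ _ _)).
have -> : @leb2 R (E `&` D) = (\int[leb]_(y in `[0%R, (b^-1 + b^-1)%R[) G y)%E.
  rewrite /leb2 /product_measure1 -/G; apply: integral_support => y /= y01.
  apply: Gout => /=; rewrite in_itv/= => /andP[y0 y1]; apply: y01.
  rewrite in_itv/= y0 (lt_trans y1)//.
  have -> : b^-1 + b^-1 = 2 / b by ring.
  by rewrite ltr_pdivlMr// mul1r.
rewrite (@ge0_integralZl_EFin _ _ _ leb) ?(ltW bV_gt0)//; first last.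
- by apply: measurable_funTS; apply: emeasurable_funD; exact: mGa.
- by move=> y _; exact: adde_ge0.
rewrite ge0_integralD//; [|by apply: measurable_funTS; exact: mGa..].
have part c s : (\int[leb]_(y in affine_map b^-1 c @^-1` `[c, s[) G (affine_map b^-1 c y) =
    b%:E * \int[leb]_(y in `[c, s[) G y)%E.
  by rewrite /leb ge0_integral_affine// ?invrK//; exact: measurable_funTS.
have -> : `[0, b^-1 + b^-1[%classic = `[0, b^-1[%classic `|` `[b^-1, b^-1 + b^-1[%classic :> set R.
  apply/seteqP; split => y; rewrite /= !in_itv/=.
    by move=> /andP[-> ->] /=; rewrite andbT; case: ltP => h; [left|right].
  move=> [] /andP[h1 h2].
    by rewrite h1 (lt_trans h2)// ltrDl.
  by rewrite h2 (le_trans _ h1)// ltW.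
rewrite /leb ge0_integral_setU//=; last 2 first.
- exact: measurable_funTS.
- apply/disj_setPS => y; rewrite /= !in_itv/= => -[/andP[_ h1] /andP[h2 _]].
  by move: (lt_le_trans h1 h2); rewrite ltxx.
rewrite -/leb ge0_muleDr; [|exact: integral_ge0..].
have lt1 (y : R) : (b^-1 * y < b^-1) = (y < 1).
  by rewrite -[X in _ < X]mulr1 ltr_pM2l.
congr (_ + _)%E.
  have -> : `[0, 1[%classic = affine_map b^-1 0 @^-1` `[0, b^-1[%classic :> set R.
    apply/seteqP; split => y; rewrite /= !in_itv/= /affine_map addr0 pmulr_rge0//.
      by rewrite lt1.
    by rewrite lt1.
  by rewrite part muleA -EFinM mulVf ?mul1e// gt_eqF.
have -> : `[0, 1[%classic = affine_map b^-1 b^-1 @^-1` `[b^-1, b^-1 + b^-1[%classic :> set R.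
  apply/seteqP; split => y; rewrite /= !in_itv/= /affine_map lerDr pmulr_rge0// ltrD2r.
    by rewrite lt1.
  by rewrite lt1.
by rewrite part muleA -EFinM mulVf ?mul1e// gt_eqF.
Qed.

(** Tonelli, then the density expanded as a series. The right side has the shape of the limit in
    [fold_map_average], so that the two can be matched. *)
Lemma integral_ext_domain_fst (F : R -> R) : measurable_fun [set: R] F ->
  (forall y, 0 <= F y) ->
  (\int[@leb2 R]_(w in D) (F w.1)%:E =
   \sum_(0 <= k <oo)
     (b^-1 ^+ k)%:E * \int[leb]_(y in `[0%R, top_orbit b k[) (F y)%:E)%E.
Proof.
move=> mF F0; pose G y := (F y)%:E.
have mG : measurable_fun [set: R] G by exact/measurable_EFinP.
have G0 y : (0 <= G y)%E by rewrite lee_fin.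
rewrite -[X in X = _]/(\int[@leb2 R]_(w in D) G w.1)%E.
rewrite -[X in _ = X]/(\sum_(0 <= k <oo)
     (b^-1 ^+ k)%:E * \int[leb]_(y in `[0%R, top_orbit b k[) G y)%E.
have mD := measurable_ext_domain b_gt1.
have mGf : measurable_fun [set: R * R] (fun w => G w.1).
  exact: (measurableT_comp mG measurable_fst).
rewrite integral_mkcond /leb2 fubini_tonelli1//; last 2 first.
- by apply/(measurable_restrictT _ mD); exact: measurable_funTS.
- by move=> w; apply: erestrict_ge0 => z _; exact: G0.
rewrite /fubini_F.
transitivity (\int[leb]_(y in `[0%R, 1%R[) (G y * (parry_density b y)%:E))%E.
  rewrite [RHS]integral_mkcond; apply: eq_integral => y _.
  rewrite [RHS]patchE; case: ifPn => [|]; rewrite ?inE ?notin_setE /= in_itv/= => y01.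
    rewrite (_ : (fun _ => _) = (fun v => G y) \_ `[0, parry_density b y[%classic).
      transitivity (\int[leb]_(v in `[0%R, parry_density b y[) cst (G y) v)%E.
        by rewrite [RHS]integral_mkcond.
      rewrite integral_cst//= lebesgue_measure_itv/= lte_fin.
      case: ltP => h; first by rewrite -EFinB subr0.
      by congr (_ * _%:E)%E; apply/eqP; rewrite eq_le h parry_density_ge0.
    apply/funext => v; rewrite !patchE; congr (if _ then _ else _).
    by apply/idP/idP; rewrite !inE /= in_itv/=; [case | move=> h; split].
  rewrite integral0_eq// => v _; rewrite patchE; case: ifPn => //.
  by rewrite inE => -[].
transitivity (\int[leb]_(y in `[0%R, 1%R[) (\sum_(0 <= k <oo) (G y * (density_term b y k)%:E)))%E.
  apply: eq_integral => y _; rewrite EFin_parry_density// nneseriesZl//.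
  by move=> k _; rewrite lee_fin density_term_ge0.
rewrite integral_nneseries//; first last.
- by move=> k y _; rewrite mule_ge0// lee_fin density_term_ge0.
- move=> k; apply: emeasurable_funM; first exact: measurable_funTS.
  by apply/measurable_EFinP; apply: measurable_funTS; exact: measurable_density_term.
apply: eq_eseriesr => k _.
have /andP[t0 t1] := top_orbit_range b_gt1 b_lt2 k.
rewrite -ge0_integralZl_EFin ?exprn_ge0 ?(ltW bV_gt0)//; last exact: measurable_funTS.
rewrite [LHS]integral_mkcond [RHS]integral_mkcond; apply: eq_integral => y _.
rewrite !patchE; case: ifPn; rewrite ?inE ?notin_setE /= in_itv/= => y01;
  case: ifPn; rewrite ?inE ?notin_setE /= in_itv/= => yt //.
- by rewrite /density_term; have /andP[_ ->] := yt; rewrite mulr1 muleC.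
- have /andP[y0 y1] := y01; move/negP: yt; rewrite y0/= /density_term => /negbTE ->.
  by rewrite mulr0 mule0.
- have /andP[y0 y1] := yt; exfalso; apply: y01.
  by rewrite y0 (lt_le_trans y1).
Qed.

Lemma leb2_ext_domain : @leb2 R D = (limn (series (parry_weight b)))%:E.
Proof.
have mD := measurable_ext_domain b_gt1.
transitivity (\int[@leb2 R]_(w in D) (cst (1 : R) w.1)%:E)%E.
  transitivity (\int[@leb2 R]_(w in D) cst 1%:E w)%E => //.
  by rewrite /leb2 integral_cst// mul1e.
rewrite integral_ext_domain_fst// -EFin_lim; last first.
  apply: (@is_cvg_series_le_geometric _ b^-1 _ _ _ 1) => //.
  - by rewrite invf_lt1.
  - exact: parry_weight_ge0.
  - by move=> k; rewrite mul1r parry_weight_le.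
congr (limn _); apply/funext => n /=; rewrite /series/= -sumEFin.
apply: eq_bigr => k _.
transitivity ((b^-1 ^+ k)%:E * \int[leb]_(y in `[0%R, top_orbit b k[) cst 1%:E y)%E => //.
rewrite integral_cst//= mul1e.
have /andP[t0 t1] := top_orbit_range b_gt1 b_lt2 k.
by rewrite lebesgue_measure_itv/= lte_fin t0 -EFinB subr0 -EFinM.
Qed.

End AreaPreservation.

(** * The invariant measure on the square *)

Section InvariantMeasure.
Context {R : realType}.
Variables (b l : R) (b_gt1 : 1 < b) (b_lt2 : b < 2) (l_gt0 : 0 < l) (l_lt1 : l < 1).

Let b_gt0 : 0 < b. Proof. exact: lt_trans b_gt1. Qed.
Let bV_gt0 : 0 < b^-1. Proof. by rewrite invr_gt0. Qed.
Let leb := @lebesgue_measure R.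
Notation D := (ext_domain b).
Notation S := (ext_back b).

Definition ext_past_term w j : R := l ^+ j * (ext_digit b (iter j S w))%:R.

Definition ext_past w : R := limn (series (ext_past_term w)).

Definition ext_point w : R * R := ((1 - l) * ext_past w, w.1).

Lemma ext_past_term_ge0 w j : 0 <= ext_past_term w j.
Proof. by rewrite mulr_ge0// exprn_ge0// ltW. Qed.

Lemma is_cvg_ext_past w : cvgn (series (ext_past_term w)).
Proof.
apply: (@is_cvg_series_le_geometric _ l _ _ _ 1) => //.
- exact: ext_past_term_ge0.
- move=> k; rewrite mul1r ler_piMr ?exprn_ge0 ?(ltW l_gt0)//.
  by case: ext_digit.
Qed.

Lemma ext_past_ge0 w : 0 <= ext_past w.
Proof.
apply: limr_ge; first exact: is_cvg_ext_past.
by apply: nearW => n; apply: sumr_ge0 => k _; exact: ext_past_term_ge0.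
Qed.

Lemma ext_past_back w : ext_past w = (ext_digit b w)%:R + l * ext_past (S w).
Proof.
have e n : series (ext_past_term w) n.+1 =
    (ext_digit b w)%:R + l * series (ext_past_term (S w)) n.
  rewrite /series/= big_nat_recl// {1}/ext_past_term expr0 mul1r; congr (_ + _).
  rewrite mulr_sumr; apply: eq_bigr => j _.
  by rewrite /ext_past_term exprS -mulrA -iterSr.
have h1 : series (ext_past_term w) n.+1 @[n --> \oo] --> ext_past w.
  by rewrite (cvg_shiftS (series (ext_past_term w))); exact: is_cvg_ext_past.
have h2 : series (ext_past_term w) n.+1 @[n --> \oo] -->
    (ext_digit b w)%:R + l * ext_past (S w).
  rewrite (_ : (fun n => _) = (fun n => (ext_digit b w)%:R +
      l * series (ext_past_term (S w)) n)); last by apply/funext => n; exact: e.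
  apply: cvgD; first exact: cvg_cst.
  by apply: cvgM; [exact: cvg_cst | exact: is_cvg_ext_past].
by rewrite -(cvg_lim _ h1)// -(cvg_lim _ h2).
Qed.

Lemma ext_past_le w : (1 - l) * ext_past w <= 1.
Proof.
have l1 : 0 < 1 - l by rewrite subr_gt0.
rewrite mulrC -ler_pdivlMr// div1r.
apply: limr_le; first exact: is_cvg_ext_past.
apply: nearW => n.
apply: (@le_trans _ _ (series (geometric 1 l) n)).
  apply: ler_sum => k _; rewrite /= mul1r.
  rewrite /ext_past_term ler_piMr ?exprn_ge0 ?(ltW l_gt0)//.
  by case: ext_digit.
have := @geometric_le_lim R n 1 l ler01 l_gt0; rewrite mul1r; apply.
by rewrite gtr0_norm.
Qed.

(* A past consisting of 1s only would push the first coordinate above the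
   fixed point [1 / (b - 1) > 1]. *)
Lemma ext_past_lt w : D w -> (1 - l) * ext_past w < 1.
Proof.
move=> Dw; rewrite lt_neqAle ext_past_le andbT; apply/eqP => e1.
have l1 : 0 < 1 - l by rewrite subr_gt0.
pose wn n := iter n S w.
have Dn n : D (wn n) by elim: n => //= n; exact: ext_back_domain.
(* The rescaled past is a convex combination of the current digit and the next rescaled past, both
   at most 1; the value 1 forces both to be 1. *)
have en n : (1 - l) * ext_past (wn n) = 1.
  elim: n => // n; rewrite /= ext_past_back => IH.
  have h := ext_past_le (wn n.+1); apply/eqP; rewrite eq_le h /= leNgt; apply/negP.
  move=> h'; suff : (1 : R) < 1 by rewrite ltxx.
  rewrite -[X in X < _]IH mulrDr mulrCA.
  have hl : l * ((1 - l) * ext_past (S (wn n))) < l by rewrite -[ltRHS]mulr1 ltr_pM2l.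
  have hd : (1 - l) * (ext_digit b (wn n))%:R <= 1 - l.
    by rewrite ler_piMr ?(ltW l1)//; case: ext_digit.
  by have := ler_ltD hd hl; rewrite subrK.
have dn n : ext_digit b (wn n).
  apply: contraT => /negbTE nd; have := en n.
  have en1 : (1 - l) * ext_past (S (wn n)) = 1 := en n.+1.
  rewrite ext_past_back nd mulr0n add0r mulrCA en1 mulr1 => l_eq1.
  by move: l_lt1; rewrite l_eq1 ltxx.
have bm1 : 0 < b - 1 by rewrite subr_gt0.
have yn n : (b - 1)^-1 - (wn n).1 = b^-1 ^+ n * ((b - 1)^-1 - w.1).
  elim: n => [|n IH]; first by rewrite expr0 mul1r.
  have wS : (wn n.+1).1 = ((wn n).1 + 1) / b.
    by rewrite [wn n.+1]/(S (wn n)) /ext_back dn.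
  rewrite exprS -mulrA -IH wS; field.
  by rewrite !gt_eqF.
have [N hN] : exists N, b^-1 ^+ N * (b - 1)^-1 < (b - 1)^-1 - 1.
  have gp : 0 < (b - 1)^-1 - 1.
    by rewrite subr_gt0 invf_gt1//; move: b_lt2; lra.
  have : (fun k => b^-1 ^+ k) @ \oo --> (0 : R).
    by apply: cvg_expr; rewrite gtr0_norm// invf_lt1.
  have e0 : 0 < ((b - 1)^-1 - 1) * (b - 1) / 2 by rewrite !mulr_gt0.
  move/cvgr0Pnorm_le => /(_ _ e0)[N _ hN]; exists N.
  have := hN N (leqnn N); rewrite ger0_norm ?exprn_ge0 ?(ltW bV_gt0)// => hN'.
  rewrite ltr_pdivrMr// (le_lt_trans hN')//.
  by rewrite ltr_pdivrMr// ltr_pMr ?mulr_gt0// ltr1n.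
have [/andP[y0 _] _] := Dw.
have [/andP[_ y1] _] := Dn N.
have : b^-1 ^+ N * ((b - 1)^-1 - w.1) <= b^-1 ^+ N * (b - 1)^-1.
  by rewrite ler_pM2l ?exprn_gt0// gerBl.
by rewrite -yn; lra.
Qed.

(** [Tbl] prepends to the past of [S w] the digit that [S] has just removed. *)
Lemma Tbl_ext_point w : D w -> Tbl b l (ext_point (S w)) = ext_point w.
Proof.
move=> Dw; have [d f] := ext_back_fold b_gt1 Dw.
rewrite Tbl_digit /ext_point /= d f [in RHS]ext_past_back; congr pair; ring.
Qed.

(** The strict bound [ext_past_lt] is spent here, since the square excludes its right edge. *)
Lemma ext_point_Qsq w : D w -> Qsq (ext_point w).
Proof.
move=> Dw; split; last by case: Dw.
by rewrite /= ext_past_lt// mulr_ge0 ?ext_past_ge0// subr_ge0 ltW.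
Qed.

Lemma measurable_ext_point : measurable_fun [set: R * R] ext_point.
Proof.
apply: measurable_fun_pair; last exact: measurable_fst.
apply: measurable_funM; first exact: measurable_cst.
apply: (@measurable_fun_cvg _ _ _ _ (fun n w => series (ext_past_term w) n)).
  move=> n; apply: measurable_sum => j.
  apply: measurable_funM; first exact: measurable_cst.
  apply: measurable_bool_natr.
  apply: (measurableT_comp (measurable_ext_digit b_gt1)).
  exact: measurable_iter (measurable_ext_back b_gt1).
by move=> w _; exact: is_cvg_ext_past.
Qed.

Let mass : R := limn (series (parry_weight b)).

Lemma parry_mass_gt0 : 0 < mass.
Proof.
have cr : cvgn (series (parry_weight b)).
  apply: (@is_cvg_series_le_geometric _ b^-1 _ _ _ 1) => //.
  - by rewrite invf_lt1.
  - exact: parry_weight_ge0.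
  - by move=> n; rewrite mul1r parry_weight_le.
apply: (@lt_le_trans _ _ 1) => //; apply: limr_ge => //.
exists 1%N => // -[//|n] _ /=.
rewrite /series/= big_mkord big_ord_recl {1}/parry_weight expr0 mulr1 lerDl.
by apply: sumr_ge0 => i _; exact: parry_weight_ge0.
Qed.

Lemma ge0_integral_mrestr d (T : measurableType d) (mu : {measure set T -> \bar R})
    (A : set T) (mA : measurable A) (f : T -> \bar R) :
  measurable_fun setT f -> (forall x, 0 <= f x)%E ->
  (\int[mrestr mu mA]_x f x = \int[mu]_(x in A) f x)%E.
Proof.
move=> mf f0; rewrite -(setUv A) ge0_integral_setU//=; last 3 first.
- exact: measurableC.
- by rewrite setUv.
- exact/disj_setPCl.
rewrite [X in (_ + X)%E](_ : _ = 0%E) ?adde0.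
  apply: eq_measure_integral => B mB BA /=; rewrite /mrestr setIidl//.
apply: null_set_integral => //; first exact: measurableC.
- exact: measurable_funTS.
- by rewrite /= /mrestr setICl measure0.
Qed.

Lemma exists_invariant_measure :
  exists mu : {measure set (R * R) -> \bar R},
  [/\ mu setT = 1%E, mu (~` @Qsq R) = 0%E,
      forall A, measurable A -> mu (Tbl b l @^-1` A) = mu A &
      forall F : R -> R, measurable_fun setT F -> (forall y, 0 <= F y) ->
      (\int[mu]_z (F z.2)%:E = mass^-1%:E * \sum_(0 <= k <oo)
        (b^-1 ^+ k)%:E * \int[leb]_(y in `[0%R, top_orbit b k[) (F y)%:E)%E].
Proof.
have mV : 0 <= mass^-1 by rewrite invr_ge0 ltW// parry_mass_gt0.
pose k : {nonneg R} := NngNum mV.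
have mD := measurable_ext_domain b_gt1.
pose L2 := ((@lebesgue_measure R) \x (@lebesgue_measure R))%E.
pose LR := measurableTypeR R.
pose rs := measure_function_mrestr__canonical__measure_function_Measure L2 mD.
pose pf := @measure_function_pushforward__canonical__measure_function_Measure
  _ _ (LR * LR)%type (R * R)%type _ rs ext_point measurable_ext_point.
pose mu : {measure set (R * R) -> \bar R} :=
  measure_function_mscale__canonical__measure_function_Measure k pf.
have muE A : mu A = (mass^-1%:E * @leb2 R (ext_point @^-1` A `&` D))%E by [].
exists mu; split.
- rewrite muE preimage_setT setTI leb2_ext_domain// -EFinM mulVf//.
  by rewrite gt_eqF// parry_mass_gt0.
- rewrite muE (_ : _ `&` _ = set0) ?/leb2 ?measure0 ?mule0//.
  by apply/seteqP; split => // w [/= nQ /ext_point_Qsq].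
- move=> A mA; rewrite !muE; congr (_ * _)%E.
  have mTA := measurable_preimage (@measurable_Tbl R b l) mA.
  (* Pulling back along the area-preserving [ext_back] makes [Tbl] cancel against it inside the
     preimage. *)
  rewrite -(leb2_ext_back b_gt1 b_lt2 (measurable_preimage measurable_ext_point mTA)).
  congr (leb2 _); apply/seteqP; split => w [/= h Dw]; split => //=.
    by rewrite -Tbl_ext_point.
  by rewrite Tbl_ext_point.
move=> F mF F0.
have mF2 : measurable_fun [set: R * R] (fun z => (F z.2)%:E).
  by apply/measurable_EFinP; exact: (measurableT_comp mF measurable_snd).
have mF1 : measurable_fun [set: R * R] (fun w => (F w.1)%:E).
  by apply/measurable_EFinP; exact: (measurableT_comp mF measurable_fst).
rewrite -(integral_ext_domain_fst b_gt1 b_lt2 mF F0).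
transitivity (mass^-1%:E * \int[pf]_z (F z.2)%:E)%E.
  refine (@ge0_integral_mscale _ _ _ pf setT measurableT k _ mF2 _).
  by move=> z _; rewrite lee_fin.
congr (_ * _)%E.
transitivity (\int[rs]_w (F w.1)%:E)%E.
  refine (@ge0_integral_pushforward _ _ (LR * LR)%type (R * R)%type R ext_point
    measurable_ext_point rs setT (fun z => (F z.2)%:E) measurableT mF2 _).
  by move=> z _; rewrite lee_fin.
apply: (@ge0_integral_mrestr _ _ L2 D mD _ mF1).
by move=> w; rewrite lee_fin.
Qed.

End InvariantMeasure.

(** * Convergence on Lipschitz functions *)

Section BoundedIntegrals.
Context {R : realType} {d : measure_display} {T : measurableType d}.
Variables (mu : {measure set T -> \bar R}) (D : set T).
Hypotheses (mD : measurable D) (muD : mu D = 1%E).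

Lemma integrable_bounded (f : T -> R) K : measurable_fun D f ->
  (forall z, D z -> `|f z| <= K) -> mu.-integrable D (EFin \o f).
Proof.
move=> mf fK; apply/integrableP; split; first exact/measurable_EFinP.
apply: (@le_lt_trans _ _ (\int[mu]_(z in D) cst K%:E z)%E); last first.
  by rewrite integral_cst// muD mule1 ltry.
apply: ge0_le_integral => //.
by apply: measurableT_comp => //; exact/measurable_EFinP.
Qed.

Lemma Rintegral_le_add (f g : T -> R) K e : measurable_fun D f ->
  measurable_fun D g -> (forall z, D z -> `|f z| <= K) ->
  (forall z, D z -> `|g z| <= K) -> (forall z, D z -> f z <= g z + e) ->
  Rintegral mu D f <= Rintegral mu D g + e.
Proof.
move=> mf mg fK gK fg.
have fi := integrable_bounded mf fK; have gi := integrable_bounded mg gK.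
have ei : mu.-integrable D (EFin \o cst e).
  by apply: (integrable_bounded (K := `|e|)) => //; exact: measurable_cst.
apply: (@le_trans _ _ (\int[mu]_(z in D) (g z + cst e z))); last first.
  by rewrite RintegralD// Rintegral_cst// muD mulr1.
apply: le_Rintegral => //.
rewrite (_ : EFin \o _ = (EFin \o g) \+ (EFin \o cst e))%E//.
exact: integrableD.
Qed.

Lemma Rintegral_bounded (f : T -> R) K : measurable_fun D f ->
  (forall z, D z -> 0 <= f z <= K) -> 0 <= Rintegral mu D f <= K.
Proof.
move=> mf fK; apply/andP; split.
  by apply: Rintegral_ge0 => z /fK /andP[].
have [[z0 Dz0]|nD] := pselect (exists z, D z); last first.
  exfalso; have D0 : D = set0 by apply/seteqP; split => // z Dz; apply: nD; exists z.
  by have := muD; rewrite D0 measure0 => /eqP; rewrite lt_eqF ?lte_fin.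
have K0 : 0 <= K by have /andP[h1 h2] := fK _ Dz0; exact: le_trans h2.
have c0 : Rintegral mu D (cst 0) = 0 by rewrite (Rintegral_cst _ mD 0) mul0r.
rewrite -[leRHS]add0r -c0; apply: (@Rintegral_le_add _ _ K) => //.
- by move=> z Dz; have /andP[h1 h2] := fK _ Dz; rewrite ger0_norm.
- by move=> z Dz; rewrite /= normr0.
- by move=> z Dz; rewrite /= add0r; have /andP[] := fK _ Dz.
Qed.

End BoundedIntegrals.

Section SRBExistence.
Context {R : realType}.
Variables (b l : R) (b_gt1 : 1 < b) (b_lt2 : b < 2) (l_gt0 : 0 < l) (l_lt1 : l < 1).
Variables (mu : {measure set (R * R) -> \bar R}).
Hypotheses (muT : mu setT = 1%E) (muQC : mu (~` @Qsq R) = 0%E).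
Hypothesis mu_inv : forall A, measurable A -> mu (Tbl b l @^-1` A) = mu A.
Hypothesis mu_marginal : forall F : R -> R, measurable_fun setT F ->
  (forall y, 0 <= F y) ->
  (\int[mu]_z (F z.2)%:E = (limn (series (parry_weight b)))^-1%:E *
    \sum_(0 <= k <oo) (b^-1 ^+ k)%:E *
    \int[@lebesgue_measure R]_(y in `[0%R, top_orbit b k[) (F y)%:E)%E.

Let b_gt0 : 0 < b. Proof. exact: lt_trans b_gt1. Qed.
Let bV_gt0 : 0 < b^-1. Proof. by rewrite invr_gt0. Qed.
Let mQ := @measurable_Qsq R.
Let L2 : {measure set (measurableTypeR R * measurableTypeR R) -> \bar R} :=
  (@lebesgue_measure R \x @lebesgue_measure R)%E.

Lemma mu_Qsq : mu (@Qsq R) = 1%E.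
Proof.
have -> : mu (@Qsq R) = (mu (@Qsq R) + mu (~` @Qsq R))%E by rewrite muQC adde0.
rewrite -muT -(setUv (@Qsq R)); apply: esym; apply: measureU => //.
  exact: measurableC.
exact: setICr.
Qed.

Lemma integral_QsqE (f : R * R -> R) : measurable_fun setT f ->
  (forall z, 0 <= f z) -> (\int[mu]_z (f z)%:E = \int[mu]_(z in @Qsq R) (f z)%:E)%E.
Proof.
move=> mf f0; have mf' : measurable_fun setT (EFin \o f) by exact/measurable_EFinP.
rewrite -[in LHS](setUv (@Qsq R)) ge0_integral_setU//=; last 4 first.
- exact: measurableC.
- by rewrite setUv.
- by move=> z _; rewrite lee_fin.
- exact/disj_setPCl.
rewrite [X in (_ + X)%E](_ : _ = 0%E) ?adde0//.
apply: null_set_integral => //; first exact: measurableC.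
exact: measurable_funTS.
Qed.

Lemma integral_Tbl (f : R * R -> R) m : measurable_fun setT f ->
  (forall z, 0 <= f z) ->
  (\int[mu]_z (f (iter m (Tbl b l) z))%:E = \int[mu]_z (f z)%:E)%E.
Proof.
move=> mf f0; elim: m => // m IH.
rewrite -IH; under eq_integral do rewrite iterSr.
set h := fun z => (f (iter m (Tbl b l) z))%:E.
have mh : measurable_fun [set: R * R] h.
  by apply/measurable_EFinP; exact: (measurableT_comp mf (measurable_iter_Tbl b l m)).
pose pf := @measure_function_pushforward__canonical__measure_function_Measure
  _ _ (R * R)%type (R * R)%type _ mu (Tbl b l) (@measurable_Tbl R b l).
transitivity (\int[pf]_z h z)%E.
  apply: esym.
  refine (@ge0_integral_pushforward _ _ (R * R)%type (R * R)%type R (Tbl b l)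
    (@measurable_Tbl R b l) mu setT h measurableT mh _).
  by move=> z _; rewrite lee_fin.
by apply: eq_measure_integral => A mA _ /=; rewrite /pushforward mu_inv.
Qed.

Lemma leb2_Qsq_snd (F : R -> R) : measurable_fun setT F -> (forall y, 0 <= F y) ->
  (\int[@leb2 R]_(z in @Qsq R) (F z.2)%:E =
   \int[@lebesgue_measure R]_(y in `[0%R, 1%R[) (F y)%:E)%E.
Proof.
move=> mF F0.
have mF2 : measurable_fun [set: R * R] (fun z => (F z.2)%:E).
  by apply/measurable_EFinP; exact: (measurableT_comp mF measurable_snd).
have mFe : measurable_fun [set: R] (fun y => (F y)%:E) by exact/measurable_EFinP.
rewrite integral_mkcond /leb2 fubini_tonelli1//; last 2 first.
- by apply/(measurable_restrictT _ mQ); exact: measurable_funTS.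
- by move=> w; apply: erestrict_ge0 => z _; rewrite lee_fin.
rewrite /fubini_F.
set I := (RHS).
transitivity (\int[@lebesgue_measure R]_(x in `[0%R, 1%R[) cst I x)%E.
  rewrite [RHS]integral_mkcond; apply: eq_integral => x _.
  rewrite [RHS]patchE; case: ifPn => [|]; rewrite ?inE ?notin_setE /= in_itv/= => x01.
    rewrite /= /I [RHS]integral_mkcond; apply: eq_integral => y _.
    rewrite !patchE; congr (if _ then _ else _).
    by apply/idP/idP; rewrite !inE /= in_itv/=; [case | move=> h; split].
  rewrite integral0_eq// => y _; rewrite patchE; case: ifPn => //.
  by rewrite inE => -[].
by rewrite integral_cst//= lebesgue_measure_itv/= lte_fin ltr01 oppr0 adde0 mule1.
Qed.

Section LipschitzTest.
Variables (g : R * R -> R) (K L : R).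
Hypotheses (mg : measurable_fun setT g) (g_range : forall z, 0 <= g z <= K).
Hypotheses (L_ge0 : 0 <= L).
Hypothesis g_lip : forall x x' y, `|g (x, y) - g (x', y)| <= L * `|x - x'|.

Let K_ge0 : 0 <= K.
Proof. by have /andP[h1 h2] := g_range (0, 0); exact: le_trans h2. Qed.

(** Orbits started on the left edge: [m] steps forget the abscissa up to [l ^+ m], leaving a
    function of the height alone. *)
Let F m y := g (iter m (Tbl b l) (0, y)).

Let mF m : measurable_fun setT (F m).
Proof.
apply: (measurableT_comp mg); apply: (measurableT_comp (measurable_iter_Tbl b l m)).
by apply: measurable_fun_pair => //; exact: measurable_cst.
Qed.

Let F_range m y : 0 <= F m y <= K. Proof. exact: g_range. Qed.

Let g_iter m z : Qsq z -> `|g (iter m (Tbl b l) z) - F m z.2| <= L * l ^+ m.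
Proof.
move=> [/andP[x0 x1] _]; rewrite /F !iter_Tbl /=.
apply: le_trans (g_lip _ _ _) _; rewrite ler_wpM2l//.
rewrite mulr0 add0r addrK ger0_norm ?mulr_ge0 ?exprn_ge0 ?(ltW l_gt0)//.
by rewrite ler_piMr ?exprn_ge0 ?(ltW l_gt0)// ltW.
Qed.

Let normK (u : R) : 0 <= u <= K -> `|u| <= K.
Proof. by move=> /andP[h1 h2]; rewrite ger0_norm. Qed.

(** Four errors of [e / 4]: freezing the abscissa under [mu] (after [m] steps, by invariance),
    freezing it under Lebesgue measure, the convergence of the averages of [F m], and the shift of
    the sum by [m]. *)
Lemma nu_ge_lipschitz e : 0 < e ->
  \forall n \near \oo, Rintegral mu (@Qsq R) g - e <= nu_n_int b l n g.
Proof.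
move=> e0.
have [m hm] : exists m, L * l ^+ m <= e / 4.
  have L1 : 0 < L + 1 by move: L_ge0; lra.
  have e4 : 0 < e / 4 / (L + 1) by rewrite !divr_gt0.
  have : (fun k => l ^+ k) @ \oo --> (0 : R) by apply: cvg_expr; rewrite gtr0_norm.
  move/cvgr0Pnorm_le => /(_ _ e4)[N _ hN]; exists N.
  have := hN N (leqnn N); rewrite ger0_norm ?exprn_ge0 ?(ltW l_gt0)//.
  rewrite ler_pdivlMr// mulrC; apply: le_trans.
  by rewrite ler_wpM2r ?exprn_ge0 ?(ltW l_gt0)//; lra.
have Fmu : Rintegral mu (@Qsq R) g <= Rintegral mu (@Qsq R) (fun z => F m z.2) + e / 4.
  have -> : Rintegral mu (@Qsq R) g =
      Rintegral mu (@Qsq R) (fun z => g (iter m (Tbl b l) z)).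
    rewrite /Rintegral -integral_QsqE//; last by move=> z; have /andP[] := g_range z.
    rewrite -(integral_Tbl m)//; last by move=> z; have /andP[] := g_range z.
    rewrite integral_QsqE//; last by move=> z; have /andP[] := g_range (iter m (Tbl b l) z).
    exact: (measurableT_comp mg (measurable_iter_Tbl b l m)).
  apply: (Rintegral_le_add (K := K) mQ mu_Qsq).
  - by apply: measurable_funTS; exact: (measurableT_comp mg (measurable_iter_Tbl b l m)).
  - by apply: measurable_funTS; exact: (measurableT_comp (mF m) measurable_snd).
  - by move=> z _; exact: normK.
  - by move=> z _; exact: normK.
  - by move=> z /(g_iter m) /ler_normlW; rewrite -lerBlDl => h; exact: le_trans h hm.
pose a k := orbit_integral b (F m) k 1.
pose c k := Rintegral (@leb2 R) (@Qsq R) (fun z => g (iter k (Tbl b l) z)).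
have lim := fold_map_average b_gt1 b_lt2 (mF m) (F_range m).
have limE : limn (series (fun k => b^-1 ^+ k * orbit_integral b (F m) 0 (top_orbit b k)))
    / limn (series (parry_weight b)) = Rintegral mu (@Qsq R) (fun z => F m z.2).
  rewrite /Rintegral -integral_QsqE; last 2 first.
  - exact: (measurableT_comp (mF m) measurable_snd).
  - by move=> z; have /andP[] := F_range m z.2.
  rewrite mu_marginal//; last by move=> y; have /andP[] := F_range m y.
  rewrite (_ : (\sum_(0 <= k <oo) _)%E = (limn (series
      (fun k => b^-1 ^+ k * orbit_integral b (F m) 0 (top_orbit b k))))%:E).
    by rewrite -EFinM /= mulrC.
  rewrite -EFin_lim; last first.
    apply: (@is_cvg_series_le_geometric _ b^-1 _ _ _ K) => //.
    - by rewrite invf_lt1.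
    - move=> k; have /andP[t0 t1] := top_orbit_range b_gt1 b_lt2 k.
      have /andP[h _] := orbit_integral_range b (mF m) (F_range m) 0 (ltW t0).
      by rewrite mulr_ge0// exprn_ge0// ltW.
    - move=> k; have /andP[t0 t1] := top_orbit_range b_gt1 b_lt2 k.
      have /andP[h h'] := orbit_integral_range b (mF m) (F_range m) 0 (ltW t0).
      rewrite mulrC ler_wpM2r ?exprn_ge0 ?(ltW bV_gt0)// (le_trans h')//.
      by rewrite ler_piMr.
  congr (limn _); apply/funext => n /=; rewrite /series/= -sumEFin.
  apply: eq_bigr => k _; rewrite EFinM; congr (_ * _)%E.
  by rewrite -(orbit_integralE b (mF m) (F_range m)).
(* Of the [k + m] steps the first [k] matter only through the height, and the last [m] are absorbed
   in [F m]. *)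
have ca k : a k - e / 4 <= c (k + m)%N.
  have -> : a k = Rintegral (@leb2 R) (@Qsq R)
      (fun z => F m (iter k (fold_map b) z.2)).
    rewrite /a /orbit_integral /Rintegral.
    rewrite (leb2_Qsq_snd (F := fun y => F m (iter k (fold_map b) y)))//.
    - exact: (measurableT_comp (mF m) (measurable_iter k (measurable_fold_map b))).
    - by move=> y; have /andP[] := F_range m (iter k (fold_map b) y).
  rewrite lerBlDr /c.
  have mid := @measurable_iter_Tbl R b l (k + m).
  apply: (@Rintegral_le_add _ _ _ L2 (@Qsq R) mQ (@leb2_Qsq R) _ _ K (e / 4)).
  - apply: measurable_funTS; apply: (measurableT_comp (mF m)).
    exact: (measurableT_comp (measurable_iter k (measurable_fold_map b)) measurable_snd).
  - by apply: measurable_funTS; exact: (measurableT_comp mg mid).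
  - by move=> z _; exact: normK.
  - by move=> z _; exact: normK.
  move=> z Qz; have Qk := iter_Tbl_Qsq k b_gt1 b_lt2 l_gt0 l_lt1 Qz.
  have := g_iter m Qk; rewrite -iterD addnC.
  rewrite [X in F m X](_ : _ = iter k (fold_map b) z.2); last by rewrite iter_Tbl.
  by rewrite ler_norml => /andP[h _]; move: h hm; lra.
have c_range k : 0 <= c k <= K.
  apply: (@Rintegral_bounded _ _ _ L2 (@Qsq R) mQ (@leb2_Qsq R)) => //.
  by apply: measurable_funTS; exact: (measurableT_comp mg (measurable_iter_Tbl b l k)).
have a_range k : 0 <= a k <= K.
  by have := orbit_integral_range b (mF m) (F_range m) k ler01; rewrite mulr1.
have e40 : 0 < e / 4 by lra.
have near1 : \forall n \near \oo, Rintegral mu (@Qsq R) (fun z => F m z.2) - e / 4 <=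
    n%:R^-1 * \sum_(k < n) a k.
  move: lim; rewrite limE => /cvgrPdist_le /(_ _ e40).
  apply: filterS => n; rewrite ler_norml => /andP[_ h]; lra.
near=> n.
have n0 : 0 < n%:R :> R by rewrite ltr0n; near: n; exact: nbhs_infty_gt.
have nm : (m <= n)%N by near: n; exact: nbhs_infty_ge.
have nN : m%:R * K <= e / 4 * n%:R.
  by rewrite -ler_pdivrMl// mulrC; near: n; exact: nbhs_infty_ger.
have h1 : Rintegral mu (@Qsq R) (fun z => F m z.2) - e / 4 <=
    n%:R^-1 * \sum_(k < n) a k by near: n; exact: near1.
(* The first [m] terms of [c] are dropped as nonnegative; the last [m] terms of [a] are worth at
   most [m * K]. *)
have sums : \sum_(k < n) a k - e / 4 * n%:R - m%:R * K <= \sum_(k < n) c k.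
  rewrite -(big_mkord xpredT a) -(big_mkord xpredT c).
  rewrite (big_cat_nat _ (n := (n - m)%N) (F := a)) ?leq_subr//=.
  rewrite (big_cat_nat _ (n := m) (F := c))//=.
  have s1 : 0 <= \sum_(0 <= k < m) c k.
    by apply: sumr_ge0 => k _; have /andP[] := c_range k.
  have s2 : \sum_(n - m <= k < n) a k <= m%:R * K.
    apply: (@le_trans _ _ (\sum_(n - m <= k < n) K)).
      by apply: ler_sum => k _; have /andP[] := a_range k.
    by rewrite sumr_const_nat subKn// mulr_natl.
  have s3 : \sum_(0 <= k < n - m) a k - e / 4 * n%:R <= \sum_(m <= k < n) c k.
    rewrite -{2}[m]add0n big_addn.
    apply: (@le_trans _ _ (\sum_(0 <= k < n - m) (a k - e / 4))).
      rewrite big_split/= lerD2l sumr_const_nat subn0 -[X in _ <= X]mulr_natr mulNr lerN2.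
      by rewrite ler_wpM2l ?(ltW e40)// ler_nat leq_subr.
    by apply: ler_sum => k _; exact: ca.
  lra.
have h2 : n%:R^-1 * \sum_(k < n) a k - e / 4 - e / 4 <= nu_n_int b l n g.
  rewrite /nu_n_int -/(c _) -[X in _ <= X]/(n%:R^-1 * \sum_(k < n) c k).
  rewrite ler_pdivlMl// !mulrBr mulrA mulfV ?gt_eqF// mul1r.
  by move: sums nN; lra.
lra.
Unshelve. all: by end_near. Qed.

End LipschitzTest.

End SRBExistence.

(** * Convergence on continuous functions *)

Section InfConvolution.
Context {R : realType}.

(** A dense sequence in the square: an infimum over countably many cones stays measurable. Codes of
    no use are sent to the origin. *)
Definition Qsq_enum (n : nat) : R * R :=
  if @unpickle (rat * rat)%type n is Some pq then
    let z : R * R := (ratr pq.1, ratr pq.2) in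
    if (0 <= z.1 < 1) && (0 <= z.2 < 1) then z else (0, 0)
  else (0, 0).

Lemma Qsq_enum_in n : Qsq (Qsq_enum n).
Proof.
have Q0 : Qsq ((0, 0) : R * R) by split; rewrite /= lexx ltr01.
rewrite /Qsq_enum; case: unpickle => // pq /=.
by case: ifP => // /andP[h1 h2]; split.
Qed.

Lemma Qsq_enum_dense (z : R * R) e : 0 < e -> Qsq z ->
  exists n, `|z.1 - (Qsq_enum n).1| < e /\ `|z.2 - (Qsq_enum n).2| < e.
Proof.
move=> e0.
have approx (x : R) : 0 <= x < 1 -> exists p : rat, 0 <= (ratr p : R) < 1 /\ `|x - ratr p| < e.
  move=> /andP[x0 x1].
  have : x < Num.min 1 (x + e) by rewrite lt_min x1 ltrDl.
  move=> /rat_in_itvoo[p]; rewrite in_itv/= lt_min => /andP[h1 /andP[h2 h3]].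
  exists p; rewrite h2 (le_trans x0) ?ltW//; split => //.
  by rewrite ler0_norm ?subr_le0 ?ltW// opprB ltrBlDl.
move=> [/approx[p [p01 pe]] /approx[q [q01 qe]]].
exists (pickle (p, q)); rewrite /Qsq_enum pickleK /=.
by rewrite p01 q01.
Qed.

Variables (f : R * R -> R) (K : R).
Hypothesis f_range : forall z, Qsq z -> 0 <= f z <= K.

Definition l1dist (z w : R * R) : R := `|z.1 - w.1| + `|z.2 - w.2|.

Let cone j (z : R * R) n := f (Qsq_enum n) + j%:R * l1dist z (Qsq_enum n).

(** The cap [K] gives a bound on the whole plane, as the Lipschitz test requires; far from the
    square the cones grow without bound. *)
Definition inf_conv (j : nat) (z : R * R) : R := Num.min K (inf (range (cone j z))).

Let f_enum n : 0 <= f (Qsq_enum n) <= K.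
Proof. exact/f_range/Qsq_enum_in. Qed.

Let K_ge0 : 0 <= K.
Proof. by have /andP[h1 h2] := f_enum 0%N; exact: le_trans h2. Qed.

Let l1dist_ge0 z w : 0 <= l1dist z w. Proof. by rewrite addr_ge0. Qed.

Let cone_ge0 j z n : 0 <= cone j z n.
Proof. by have /andP[h _] := f_enum n; rewrite addr_ge0// mulr_ge0. Qed.

Let cone_lb j z : has_lbound (range (cone j z)).
Proof. by exists 0 => _ [n _ <-]. Qed.

Lemma inf_conv_range j z : 0 <= inf_conv j z <= K.
Proof.
rewrite /inf_conv ge_min lexx andbT le_min K_ge0 /=.
by apply: lb_le_inf => [|_ [n _ <-]//]; exists (cone j z 0%N), 0%N.
Qed.

Lemma inf_conv_lip j x x' y :
  `|inf_conv j (x, y) - inf_conv j (x', y)| <= j%:R * `|x - x'|.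
Proof.
have half (u v : R) : inf_conv j (u, y) <= inf_conv j (v, y) + j%:R * `|u - v|.
  have d0 : 0 <= j%:R * `|u - v| by rewrite mulr_ge0.
  rewrite /inf_conv -lerBlDr le_min lerBlDr; apply/andP; split.
    by rewrite ge_min lerDl d0.
  apply: lb_le_inf; first by exists (cone j (v, y) 0%N), 0%N.
  move=> _ [n _ <-]; rewrite lerBlDr ge_min; apply/orP; right.
  apply: (@le_trans _ _ (cone j (u, y) n)); first by apply: ge_inf => //; exists n.
  rewrite /cone -addrA lerD2l -mulrDr ler_wpM2l// /l1dist /= addrAC lerD2r.
  by rewrite addrC ler_distD.
by rewrite ler_distl; have h1 := half x x'; have := half x' x;
  rewrite distrC => h2; apply/andP; split; lra.
Qed.

Lemma measurable_inf_conv j : measurable_fun [set: R * R] (inf_conv j).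
Proof.
apply: measurable_minr; first exact: measurable_cst.
rewrite (_ : (fun _ => _) = (fun z => infs (cone j z) 0%N)).
  apply: (measurable_fun_infs (h := fun n z => cone j z n)).
    by move=> z _; exact: cone_lb.
  move=> n; apply: measurable_funD; first exact: measurable_cst.
  apply: measurable_funM; first exact: measurable_cst.
  apply: measurable_funD; apply: measurableT_comp => //; apply: measurable_funB;
    try exact: measurable_cst.
    exact: measurable_fst.
  exact: measurable_snd.
apply/funext => z; rewrite /infs; congr inf.
by apply/seteqP; split => _ [n _ <-]; exists n.
Qed.

Hypothesis f_cont : {within @Qsq R, continuous f}.

Lemma Qsq_continuous_dist z e : Qsq z -> 0 < e -> exists2 r, 0 < r &
  forall w, Qsq w -> `|z.1 - w.1| < r -> `|z.2 - w.2| < r -> `|f z - f w| < e.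
Proof.
move=> Qz e0; have := (@subspace_continuousP _ _ _ f).1 f_cont z Qz.
move=> /cvgrPdist_lt /(_ _ e0); rewrite near_withinE => /nbhs_ballP[r /= r0 hr].
by exists r => // w Qw h1 h2; apply: hr => //; split.
Qed.

(** Since [z] may be absent from the dense sequence, continuity at [z] supplies a nearby apex: one
    [e / 2] for the change of [f], one for the slope [j]. *)
Lemma inf_conv_le j z : Qsq z -> inf_conv j z <= f z.
Proof.
move=> Qz; rewrite /inf_conv ge_min; apply/orP; right.
apply/ler_addgt0Pr => e e0.
have e2 : 0 < e / 2 by rewrite divr_gt0.
have [r r0 hr] := Qsq_continuous_dist Qz e2.
have j0 : 0 < j%:R + 1 :> R by rewrite ltr_wpDl.
pose s := Num.min r (e / 4 / (j%:R + 1)).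
have s0 : 0 < s by rewrite lt_min r0 !divr_gt0.
have [n [h1 h2]] := Qsq_enum_dense s0 Qz.
apply: (@le_trans _ _ (cone j z n)); first by apply: ge_inf => //; exists n.
have sr : s <= r by rewrite ge_min lexx.
have se : s * (j%:R + 1) <= e / 4 by rewrite -ler_pdivlMr// ge_min lexx orbT.
have hf := hr _ (Qsq_enum_in n) (lt_le_trans h1 sr) (lt_le_trans h2 sr).
have hd : j%:R * l1dist z (Qsq_enum n) <= e / 2.
  apply: (@le_trans _ _ ((j%:R + 1) * (s + s))); last lra.
  rewrite ler_pM//; first by rewrite lerDl.
  by rewrite lerD// ltW.
by move: hf; rewrite /cone ltr_norml => /andP[? ?]; lra.
Qed.

(** Cones with apex at distance at least [r] exceed [K] once [j * r >= K]; nearer apices carry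
    values of [f] close to [f z]. *)
Lemma inf_conv_cvg z : Qsq z -> inf_conv j z @[j --> \oo] --> f z.
Proof.
move=> Qz; apply/cvgrPdist_le => e e0.
have [r r0 hr] := Qsq_continuous_dist Qz e0.
near=> j.
have jK : K <= j%:R * r.
  by rewrite -ler_pdivrMr//; near: j; exact: nbhs_infty_ger.
have h1 := inf_conv_le j Qz.
have /andP[fz0 fzK] := f_range Qz.
rewrite ger0_norm ?subr_ge0// lerBlDr addrC -lerBlDr /inf_conv le_min.
apply/andP; split; first lra.
apply: lb_le_inf; first by exists (cone j z 0%N), 0%N.
move=> _ [n _ <-]; have /andP[fn0 fnK] := f_enum n.
have [hn|hn] := ltP (l1dist z (Qsq_enum n)) r.
  have d1 : `|z.1 - (Qsq_enum n).1| < r by rewrite (le_lt_trans _ hn)// lerDl.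
  have d2 : `|z.2 - (Qsq_enum n).2| < r by rewrite (le_lt_trans _ hn)// lerDr.
  have := hr _ (Qsq_enum_in n) d1 d2; rewrite ltr_norml => /andP[_ h].
  have : 0 <= j%:R * l1dist z (Qsq_enum n) by rewrite mulr_ge0.
  rewrite /cone; lra.
have : j%:R * r <= j%:R * l1dist z (Qsq_enum n) by rewrite ler_wpM2l.
rewrite /cone; lra.
Unshelve. all: by end_near. Qed.

Lemma measurable_fun_Qsq_continuous : measurable_fun (@Qsq R) f.
Proof.
apply: (@measurable_fun_cvg _ _ _ _ inf_conv); last exact: inf_conv_cvg.
by move=> j; apply: measurable_funTS; exact: measurable_inf_conv.
Qed.

End InfConvolution.

Section Existence.
Context {R : realType}.
Variables (b l : R) (b_gt1 : 1 < b) (b_lt2 : b < 2) (l_gt0 : 0 < l) (l_lt1 : l < 1).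

Let mQ := @measurable_Qsq R.
Let L2 : {measure set (measurableTypeR R * measurableTypeR R) -> \bar R} :=
  (@lebesgue_measure R \x @lebesgue_measure R)%E.

Lemma measurable_fun_orbit (f : R * R -> R) k : measurable_fun (@Qsq R) f ->
  measurable_fun (@Qsq R) (fun z => f (iter k (Tbl b l) z)).
Proof.
move=> mf; apply: (measurable_comp mQ _ mf).
  by move=> _ [z Qz <-]; exact: iter_Tbl_Qsq.
by apply: measurable_funTS; exact: measurable_iter_Tbl.
Qed.

Lemma exists_SRB_limit : exists mu, is_SRB_limit b l mu.
Proof.
have [mu [muT muQC mu_inv mu_marg]] := exists_invariant_measure b_gt1 b_lt2 l_gt0 l_lt1.
have muQ : mu (@Qsq R) = 1%E by exact: mu_Qsq.
exists mu; split => //; split => //.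
(* Dominated convergence picks a minorant [inf_conv f K j] whose integral is within [e / 2] of that
   of [f]; its averages bound those of [f] from below. *)
have lower (f : R * R -> R) (K e : R) : {within @Qsq R, continuous f} ->
    (forall z, Qsq z -> 0 <= f z <= K) -> 0 < e ->
    \forall n \near \oo, Rintegral mu (@Qsq R) f - e <= nu_n_int b l n f.
  move=> cf fK e0; have e2 : 0 < e / 2 by rewrite divr_gt0.
  have mf := measurable_fun_Qsq_continuous fK cf.
  have fn z : Qsq z -> `|f z| <= K.
    by move=> /fK /andP[h1 h2]; rewrite ger0_norm.
  have fi := integrable_bounded mQ muQ mf fn.
  pose g j := inf_conv f K j.
  have mg j : measurable_fun [set: R * R] (g j) by exact: measurable_inf_conv.
  have gr j z : 0 <= g j z <= K by exact: inf_conv_range.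
  have gn j z : `|g j z| <= K by have /andP[h1 h2] := gr j z; rewrite ger0_norm.
  have : Rintegral mu (@Qsq R) (g j) @[j --> \oo] --> Rintegral mu (@Qsq R) f.
    apply: fine_cvg; rewrite /Rintegral fineK; last exact: integrable_fin_num.
    apply: (@dominated_cvg _ _ _ mu _ mQ (fun j => EFin \o g j) _ (cst K%:E)).
    - by move=> j; apply/measurable_EFinP; exact: measurable_funTS.
    - by move=> z Qz; apply: cvg_EFin; [exact: nearW | exact: inf_conv_cvg].
    - by [].
    - apply: (integrable_bounded mQ muQ (f := cst K) (K := `|K|)) => //.
    - by move=> j z _; rewrite /= lee_fin.
  move=> /cvgrPdist_le /(_ _ e2)[j _ /(_ j (leqnn j))].
  rewrite ler_norml => /andP[_ hj].
  have g_lip : forall x x' y, `|g j (x, y) - g j (x', y)| <= j%:R * `|x - x'|.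
    by move=> *; exact: inf_conv_lip.
  have := @nu_ge_lipschitz _ b l b_gt1 b_lt2 l_gt0 l_lt1 mu muT muQC mu_inv mu_marg
    (g j) K j%:R (mg j) (gr j) (ler0n _ _) g_lip _ e2.
  apply: filterS => n hn.
  suff : nu_n_int b l n (g j) <= nu_n_int b l n f by move: hn hj; lra.
  rewrite /nu_n_int ler_wpM2l ?invr_ge0//; apply: ler_sum => k _.
  rewrite -[leRHS]addr0.
  apply: (@Rintegral_le_add _ _ _ L2 (@Qsq R) mQ (@leb2_Qsq R) _ _ K 0).
  - by apply: measurable_fun_orbit; exact: measurable_funTS.
  - exact: measurable_fun_orbit.
  - by [].
  - by move=> z Qz; apply: fn; exact: iter_Tbl_Qsq.
  - by move=> z Qz; rewrite addr0; apply: inf_conv_le => //; exact: iter_Tbl_Qsq.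
move=> f cf [M fM].
(* Both [f + M] and [M - f] take values in [[0, 2 * M]]; the lower bound for the second is the upper
   bound for [f]. *)
pose K := 2 * M.
have fp z : Qsq z -> 0 <= f z + M <= K.
  by move=> /fM; rewrite ler_norml /K => /andP[? ?]; apply/andP; split; lra.
have fm z : Qsq z -> 0 <= M - f z <= K.
  by move=> /fM; rewrite ler_norml /K => /andP[? ?]; apply/andP; split; lra.
have cfp : {within @Qsq R, continuous (fun z => f z + M)}.
  by move=> z; apply: cvgD; [exact: cf | exact: cvg_cst].
have cfm : {within @Qsq R, continuous (fun z => M - f z)}.
  by move=> z; apply: cvgB; [exact: cvg_cst | exact: cf].
have mf : measurable_fun (@Qsq R) f.
  have := measurable_fun_Qsq_continuous fp cfp => h.
  rewrite (_ : f = (fun z => f z + M) \- cst M); last by apply/funext => z /=; rewrite addrK.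
  by apply: measurable_funB => //; exact: measurable_cst.
have Rp d (T : measurableType d) (nu : {measure set T -> \bar R}) (D : set T)
    (h : T -> R) : measurable D -> nu D = 1%E -> measurable_fun D h ->
    (forall z, D z -> `|h z| <= M) ->
    Rintegral nu D (fun z => h z + M) = Rintegral nu D h + M /\
    Rintegral nu D (fun z => M - h z) = M - Rintegral nu D h.
  move=> mD nD mh hM.
  have hi := integrable_bounded mD nD mh hM.
  have Mi : nu.-integrable D (EFin \o cst M).
    by apply: (integrable_bounded mD nD (f := cst M) (K := `|M|)) => //; exact: measurable_cst.
  split.
    transitivity (Rintegral nu D (fun z => h z + cst M z)) => //.
    by rewrite RintegralD// (Rintegral_cst _ mD M) nD mulr1.
  transitivity (Rintegral nu D (fun z => cst M z - h z)) => //.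
  by rewrite RintegralB// (Rintegral_cst _ mD M) nD mulr1.
have nup n : (0 < n)%N -> nu_n_int b l n (fun z => f z + M) = nu_n_int b l n f + M /\
    nu_n_int b l n (fun z => M - f z) = M - nu_n_int b l n f.
  move=> n0.
  have fo k z : Qsq z -> `|f (iter k (Tbl b l) z)| <= M.
    by move=> Qz; apply: fM; exact: iter_Tbl_Qsq.
  have h k := Rp _ _ L2 (@Qsq R) _ mQ (@leb2_Qsq R) (measurable_fun_orbit k mf) (fo k).
  have nn : n%:R != 0 :> R by rewrite pnatr_eq0 -lt0n.
  rewrite /nu_n_int; split.
    rewrite (eq_bigr (fun k : 'I_n =>
      Rintegral (@leb2 R) (@Qsq R) (fun z => f (iter k (Tbl b l) z)) + M)).
      by rewrite big_split/= sumr_const card_ord -[M *+ n]mulr_natl mulrDr mulKf.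
    by move=> k _; have [h1 _] := h k; exact: h1.
  rewrite (eq_bigr (fun k : 'I_n =>
    M - Rintegral (@leb2 R) (@Qsq R) (fun z => f (iter k (Tbl b l) z)))).
    by rewrite sumrB/= sumr_const card_ord -[M *+ n]mulr_natl mulrBr mulKf.
  by move=> k _; have [_ h2] := h k; exact: h2.
have [mup mum] := Rp _ _ mu (@Qsq R) f mQ muQ mf fM.
apply/cvgrPdist_le => e e0.
have n1 := lower _ _ _ cfp fp e0; have n2 := lower _ _ _ cfm fm e0.
near=> n.
have n0 : (0 < n)%N by near: n; exact: nbhs_infty_gt.
have [e1 e2] := nup n n0.
have : Rintegral mu (@Qsq R) (fun z => f z + M) - e <= nu_n_int b l n (fun z => f z + M).
  by near: n; exact: n1.
have : Rintegral mu (@Qsq R) (fun z => M - f z) - e <= nu_n_int b l n (fun z => M - f z).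
  by near: n; exact: n2.
rewrite e1 e2 mup mum ler_norml => h1 h2; apply/andP; split; lra.
Unshelve. all: by end_near. Qed.

End Existence.

Unset Implicit Arguments.

Theorem theorem4p1 (R : realType) (beta : R) (hb1 : 1 < beta) (hb2 : beta < 2) :
  let gamma := inf [set b' | Sset b' /\ beta <= b'] in
  {ae (@lebesgue_measure R), forall lambda : R,
     lambda \in `]0, gamma^-1[ ->
     (exists mu, is_SRB_limit beta lambda mu) /\
     forall mu, is_SRB_limit beta lambda mu ->
       hausdorff_dim_measure mu = (1 + ln beta / ln lambda^-1)%:E}.
Proof.
set A := [set b' | Sset b' /\ beta <= b'] => gamma.
apply: aeW => lambda; rewrite in_itv/= => /andP[l0 lg].
(* For an empty set the infimum is 0 by convention, and so is its inverse: the interval of [lambda]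
   is empty. *)
have [A0|nA0] := pselect (A !=set0); last first.
  have AE : A = set0 by apply/seteqP; split => // x Ax; apply: nA0; exists x.
  by move: lg; rewrite /gamma AE inf0 invr0 ltNge (ltW l0).
have beta_gt0 : 0 < beta by exact: lt_trans hb1.
have bg : beta <= gamma by apply: lb_le_inf => // x [].
have g0 : 0 < gamma by exact: lt_le_trans bg.
(* The infimum may fail to be attained; the strict inequality [lambda < gamma^-1] leaves room for a
   base in [Sset]. *)
have [g [gS bgg] gl] : exists2 g, A g & g < lambda^-1.
  apply: inf_lt => //.
  by rewrite -[X in X < _]invrK ltf_pV2// posrE invr_gt0.
have lgV : lambda < g^-1.
  rewrite -[X in X < _]invrK ltf_pV2// posrE ?invr_gt0//.
  exact: lt_le_trans bgg.
have l1 : lambda < 1.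
  by apply: lt_trans lgV _; rewrite invf_lt1 (lt_le_trans _ bgg).
split; first exact: exists_SRB_limit.
by move=> mu mu_SRB; exact: (SRB_dim hb1 hb2 l0 l1 mu_SRB bgg gS lgV).
Qed.
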